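(* Let $\mathcal C$ and $\mathcal C'$ be triangulated categories endowed with weight structures $w$ and $w'$, respectively; let $F:\mathcal C\to\mathcal C'$ be a weight-exact functor. Assume that the induced functor $\underline{HF}:\underline{Hw}\to\underline{Hw}'$ between the hearts is full, that any $\underline{Hw}$-endomorphism killed by $\underline{HF}$ is nilpotent, and that for some $M\in\operatorname{Obj}\mathcal C$ the object $F(M)$ is without weights $m,\dots,n$ for some integers $m\le n$ (resp. $F(M)$ is $w'$-degenerate, resp. $F(M)$ is essentially $w'$-positive, resp. $F(M)$ is essentially $w'$-negative). Then $M$ is without weights $m,\dots,n$ (resp. $M$ is $w$-degenerate, resp. essentially $w$-positive, resp. essentially $w$-negative).
   Context: Weight structures. A weight structure $w$ on a triangulated category $\mathcal C$ is a pair of classes $\mathcal C_{w\le 0},\mathcal C_{w\ge 0}\subset\operatorname{Obj}\mathcal C$ such that: (i) both are closed under retracts; (ii) $\mathcal C_{w\le 0}\subset\mathcal C_{w\le 0}[1]$ and $\mathcal C_{w\ge 0}[1]\subset\mathcal C_{w\ge 0}$; (iii) $\mathcal C(X,Y)=0$ for $X\in\mathcal C_{w\le 0}$, $Y\in\mathcal C_{w\ge 0}[1]$; (iv) every object $M$ fits into a distinguished triangle $LM\to M\to RM\to LM[1]$ with $LM\in\mathcal C_{w\le 0}$, $RM\in\mathcal C_{w\ge 0}[1]$. Put $\mathcal C_{w\ge i}=\mathcal C_{w\ge 0}[i]$, $\mathcal C_{w\le i}=\mathcal C_{w\le 0}[i]$, $\mathcal C_{w=i}=\mathcal C_{w\ge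 i}\cap\mathcal C_{w\le i}$. The heart $\underline{Hw}$ is the full subcategory of $\mathcal C$ with object class $\mathcal C_{w=0}$. An $m$-weight decomposition of $M$ is a (non-canonical) distinguished triangle $w_{\le m}M\to M\to w_{\ge m+1}M\to (w_{\le m}M)[1]$ with $w_{\le m}M\in\mathcal C_{w\le m}$ and $w_{\ge m+1}M\in\mathcal C_{w\ge m+1}$. An exact functor $F:\mathcal C\to\mathcal C'$ is weight-exact if it maps $\mathcal C_{w\le 0}$ into $\mathcal C'_{w'\le 0}$ and $\mathcal C_{w\ge 0}$ into $\mathcal C'_{w'\ge 0}$. For $m\le n$, $M$ is without weights $m,\dots,n$ if for some choice of an $n$-weight decomposition and an $(m-1)$-weight decomposition of $M$ the composition $w_{\le n}M\to M\to w_{\ge m}M$ is zero (this does not depend on the choices). An object $C$ is an extension of $B$ by $A$ if there is a distinguished triangle $A\to C\to B\to A[1]$. $M$ is left (resp. right) $w$-degenerate if $M\in\bigcap_{i\in\mathbb Z}\mathcal C_{w\ge i}$ (resp. $M\in\bigcap_{i\in\mathbb Z}\mathcal C_{w\le i}$). $M$ is essentially $w$-positive (resp. essentially $w$-negative) if it is a retract of some $M'\in\operatorname{Obj}\mathcal C$ that is an extension of an element of $\mathcal C_{w\ge 0}$ by a right $w$-degenerate object (resp. an extension of a left $w$-degenerate object by an element of $\mathcal C_{w\le 0}$). $M$ is $w$-degenerate if its weight complex $t(M)$ is zero in $K(\underline{Hw})$ (the homotopy category of unbounded cohomological complexes over $\underline{Hw}$). Here $t(M)=(M^i)$ is constructed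 as follows: choose weight decompositions with first arrows $c_n:w_{\le n}M\to M$ for all $n\in\mathbb Z$; there is a unique $g_n:w_{\le n}M\to w_{\le n+1}M$ with $c_{n+1}g_n=c_n$; choose distinguished triangles $w_{\le n-1}M\xrightarrow{g_{n-1}}w_{\le n}M\to M^{-n}[n]\to(w_{\le n-1}M)[1]$; then $M^{-n}\in\mathcal C_{w=0}$, and the differentials $M^{-n}\to M^{1-n}$ are the compositions $M^{-n}[n]\to(w_{\le n-1}M)[1]\to M^{1-n}[n]$ shifted by $[-n]$. The homotopy type of $t(M)$ does not depend on the choices. *)

(* Defs.v *)
From mathcomp Require Import all_boot all_order ssralg ssrnum ssrint.

Set Implicit Arguments.
Unset Strict Implicit.
Unset Printing Implicit Defensive.

Import Order.TTheory GRing.Theory Num.Theory.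
Local Open Scope ring_scope.

(* MathComp has no category theory, so triangulated categories are set up here
   from scratch.  Hom-groups are [zmodType]s, objects are compared only up to
   isomorphism, and the shift is an autoequivalence (a strictly invertible
   shift is a special case). *)

Reserved Notation "g \oc f" (at level 40, left associativity).
Reserved Notation "X ~= Y" (at level 70, no associativity).

Record preadditive := Preadditive {
  ob :> Type;
  mor : ob -> ob -> zmodType;
  idm : forall X, mor X X;
  compm : forall X Y Z, mor Y Z -> mor X Y -> mor X Z;
  compmA : forall W X Y Z (h : mor Y Z) (g : mor X Y) (f : mor W X),
    compm h (compm g f) = compm (compm h g) f;
  comp1m : forall X Y (f : mor X Y), compm (idm Y) f = f;
  compm1 : forall X Y (f : mor X Y), compm f (idm X) = f;
  compmDl : forall X Y Z (g g' : mor Y Z) (f : mor X Y),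
    compm (g + g') f = compm g f + compm g' f;
  compmDr : forall X Y Z (g : mor Y Z) (f f' : mor X Y),
    compm g (f + f') = compm g f + compm g f'
}.

Arguments idm {p} X.
Notation "g \oc f" := (compm g f) : ring_scope.

Section Preadditive.
Variable A : preadditive.

Definition is_iso (X Y : A) (f : mor X Y) : Prop :=
  exists g : mor Y X, g \oc f = idm X /\ f \oc g = idm Y.

Definition isomorphic (X Y : A) : Prop := exists f : mor X Y, is_iso f.

Definition retract_of (X Y : A) : Prop :=
  exists (i : mor X Y) (p : mor Y X), p \oc i = idm X.

Definition is_zero_object (Z : A) : Prop :=
  (forall X (f : mor X Z), f = 0) /\ (forall X (f : mor Z X), f = 0).

Definition is_biproduct (X Y S : A) (i1 : mor X S) (i2 : mor Y S)
    (p1 : mor S X) (p2 : mor S Y) : Prop :=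
  [/\ p1 \oc i1 = idm X, p2 \oc i2 = idm Y, p1 \oc i2 = 0, p2 \oc i1 = 0
    & i1 \oc p1 + i2 \oc p2 = idm S].

Definition is_additive : Prop :=
  (exists Z, is_zero_object Z) /\
  (forall X Y, exists S i1 i2 p1 p2, @is_biproduct X Y S i1 i2 p1 p2).

Definition nilpotent_endo (X : A) (e : mor X X) : Prop :=
  exists k : nat, iter k (compm e) (idm X) = 0.

Definition full_subcat (P : A -> Prop) : preadditive :=
  @Preadditive {X : A | P X} (fun X Y => mor (sval X) (sval Y))
    (fun X => idm (sval X)) (fun X Y Z g f => g \oc f)
    (fun _ _ _ _ h g f => compmA h g f)
    (fun _ _ f => comp1m f) (fun _ _ f => compm1 f)
    (fun _ _ _ g g' f => compmDl g g' f) (fun _ _ _ g f f' => compmDr g f f').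

End Preadditive.

Notation "X ~= Y" := (isomorphic X Y) : ring_scope.

Record functor (A B : preadditive) := Functor {
  fob :> A -> B;
  fmap : forall X Y, mor X Y -> mor (fob X) (fob Y);
  fmap1 : forall X, fmap (idm X) = idm (fob X);
  fmapM : forall X Y Z (g : mor Y Z) (f : mor X Y),
    fmap (g \oc f) = fmap g \oc fmap f;
  fmapD : forall X Y (f f' : mor X Y), fmap (f + f') = fmap f + fmap f'
}.

Arguments fmap {A B} F {X Y} f : rename.

Definition full (A B : preadditive) (F : functor A B) : Prop :=
  forall (X Y : A) (g : mor (F X) (F Y)), exists f : mor X Y, fmap F f = g.

Definition idF (A : preadditive) : functor A A :=
  @Functor A A id (fun _ _ f => f) (fun _ => erefl) (fun _ _ _ _ _ => erefl)
    (fun _ _ _ _ => erefl).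

Section CompF.
Variables (A B D : preadditive) (G : functor B D) (F : functor A B).

Fact compF1 X : fmap G (fmap F (idm X)) = idm (G (F X)).
Proof. by rewrite !fmap1. Qed.

Fact compFM X Y Z (g : mor Y Z) (f : mor X Y) :
  fmap G (fmap F (g \oc f)) = fmap G (fmap F g) \oc fmap G (fmap F f).
Proof. by rewrite !fmapM. Qed.

Fact compFD X Y (f f' : mor X Y) :
  fmap G (fmap F (f + f')) = fmap G (fmap F f) + fmap G (fmap F f').
Proof. by rewrite !fmapD. Qed.

Definition compF : functor A D :=
  @Functor A D (fun X => G (F X)) (fun _ _ f => fmap G (fmap F f))
    compF1 compFM compFD.

End CompF.

Fixpoint iterF (A : preadditive) (n : nat) (F : functor A A) : functor A A :=
  if n is k.+1 then compF F (iterF k F) else idF A.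

(* The axioms on [dist] are Verdier's TR1 ([dist_iso], [dist_id], [dist_cone]),
   TR2, TR3 and the octahedral axiom, in this order. *)
Record triangulated := Triangulated {
  tcat :> preadditive;
  tcat_additive : is_additive tcat;
  susp : functor tcat tcat;
  desusp : functor tcat tcat;
  susp_counit : forall X, mor (susp (desusp X)) X;
  susp_counit_iso : forall X, is_iso (susp_counit X);
  susp_counit_nat : forall X Y (f : mor X Y),
    f \oc susp_counit X = susp_counit Y \oc fmap susp (fmap desusp f);
  susp_unit : forall X, mor X (desusp (susp X));
  susp_unit_iso : forall X, is_iso (susp_unit X);
  susp_unit_nat : forall X Y (f : mor X Y),
    susp_unit Y \oc f = fmap desusp (fmap susp f) \oc susp_unit X;
  (* [dist f g h]: the triangle X -f-> Y -g-> Z -h-> X[1] is distinguished *)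
  dist : forall X Y Z, mor X Y -> mor Y Z -> mor Z (susp X) -> Prop;
  dist_iso : forall X Y Z X' Y' Z'
      (f : mor X Y) (g : mor Y Z) (h : mor Z (susp X))
      (f' : mor X' Y') (g' : mor Y' Z') (h' : mor Z' (susp X'))
      (a : mor X X') (b : mor Y Y') (c : mor Z Z'),
    is_iso a -> is_iso b -> is_iso c ->
    b \oc f = f' \oc a -> c \oc g = g' \oc b ->
    fmap susp a \oc h = h' \oc c ->
    dist f g h -> dist f' g' h';
  dist_id : forall X Z, is_zero_object Z ->
    dist (idm X) (0 : mor X Z) (0 : mor Z (susp X));
  dist_cone : forall X Y (f : mor X Y),
    exists Z (g : mor Y Z) (h : mor Z (susp X)), dist f g h;
  dist_rot : forall X Y Z (f : mor X Y) (g : mor Y Z) (h : mor Z (susp X)),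
    dist f g h <-> dist g h (- fmap susp f);
  dist_map : forall X Y Z X' Y' Z'
      (f : mor X Y) (g : mor Y Z) (h : mor Z (susp X))
      (f' : mor X' Y') (g' : mor Y' Z') (h' : mor Z' (susp X'))
      (a : mor X X') (b : mor Y Y'),
    dist f g h -> dist f' g' h' -> b \oc f = f' \oc a ->
    exists c : mor Z Z', c \oc g = g' \oc b /\ fmap susp a \oc h = h' \oc c;
  dist_oct : forall X Y Z X' Y' Z'
      (f : mor X Y) (u : mor Y Z') (u' : mor Z' (susp X))
      (g : mor Y Z) (v : mor Z X') (v' : mor X' (susp Y))
      (t : mor Z Y') (t' : mor Y' (susp X)),
    dist f u u' -> dist g v v' -> dist (g \oc f) t t' ->
    exists (a : mor Z' Y') (b : mor Y' X'),
      dist a b (fmap susp u \oc v') /\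
      [/\ a \oc u = t \oc g, t' \oc a = u', b \oc t = v
        & v' \oc b = fmap susp f \oc t']
}.

Arguments susp {C} : rename.
Arguments desusp {C} : rename.
Arguments susp_counit {C} X : rename.
Arguments susp_unit {C} X : rename.

Section Shift.
Variable C : triangulated.

Definition shift (i : int) : functor C C :=
  match i with
  | Posz n => iterF n susp
  | Negz n => iterF n.+1 desusp
  end.

Fact shift_succ_pos (n : nat) : Posz n.+1 = Posz n + 1.
Proof. by rewrite -addn1 PoszD. Qed.

Fact shift_succ_neg (n : nat) : Negz n = Negz n.+1 + 1.
Proof. by rewrite !NegzE -[in RHS]addn1 PoszD opprD addrNK. Qed.

(* The canonical isomorphism X[i][1] ~= X[i+1]: it is the identity for i >= 0
   and the counit of the shift equivalence for i < 0. *)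
Definition shiftS (i : int) (X : C) : mor (susp (shift i X)) (shift (i + 1) X) :=
  match i return mor (susp (shift i X)) (shift (i + 1) X) with
  | Posz n => ecast j (mor (susp (shift (Posz n) X)) (shift j X))
                (shift_succ_pos n) (idm (shift (Posz n.+1) X))
  | Negz 0 => susp_counit X
  | Negz k.+1 => ecast j (mor (susp (shift (Negz k.+1) X)) (shift j X))
                   (shift_succ_neg k) (susp_counit (shift (Negz k) X))
  end.

(* The class P[i], closed under isomorphism because the shift is only an
   equivalence. *)
Definition shift_class (P : C -> Prop) (i : int) (X : C) : Prop :=
  exists Y : C, P Y /\ X ~= shift i Y.

Definition extension_of (B A X : C) : Prop :=
  exists (f : mor A X) (g : mor X B) (h : mor B (susp A)), dist f g h.

End Shift.

Record exact_functor (C C' : triangulated) := ExactFunctor {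
  efun :> functor C C';
  efun_susp : forall X : C, mor (efun (susp X)) (susp (efun X));
  efun_susp_iso : forall X, is_iso (efun_susp X);
  efun_susp_nat : forall (X Y : C) (f : mor X Y),
    efun_susp Y \oc fmap efun (fmap susp f)
      = fmap susp (fmap efun f) \oc efun_susp X;
  efun_dist : forall (X Y Z : C) (f : mor X Y) (g : mor Y Z)
      (h : mor Z (susp X)),
    dist f g h -> dist (fmap efun f) (fmap efun g) (efun_susp X \oc fmap efun h)
}.

Record weight_structure (C : triangulated) := WeightStructure {
  wle0 : C -> Prop;
  wge0 : C -> Prop;
  wle0_retract : forall X Y : C, retract_of X Y -> wle0 Y -> wle0 X;
  wge0_retract : forall X Y : C, retract_of X Y -> wge0 Y -> wge0 X;
  wle0_shift : forall X, wle0 X -> shift_class wle0 1 X;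
  wge0_shift : forall X, shift_class wge0 1 X -> wge0 X;
  weight_orth : forall X Y (f : mor X Y),
    wle0 X -> shift_class wge0 1 Y -> f = 0;
  weight_dec : forall M, exists (LM RM : C)
      (a : mor LM M) (b : mor M RM) (d : mor RM (susp LM)),
    [/\ dist a b d, wle0 LM & shift_class wge0 1 RM]
}.

Section Weights.
Variables (C : triangulated) (w : weight_structure C).

Definition wle (i : int) : C -> Prop := shift_class (wle0 w) i.
Definition wge (i : int) : C -> Prop := shift_class (wge0 w) i.
Definition weq (i : int) (X : C) : Prop := wge i X /\ wle i X.

Definition heart : preadditive := full_subcat (weq 0).

Definition weight_decomposition (m : int) (M A B : C)
    (a : mor A M) (b : mor M B) (d : mor B (susp A)) : Prop :=
  [/\ dist a b d, wle m A & wge (m + 1) B].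

Definition without_weights (m n : int) (M : C) : Prop :=
  exists (A B : C) (a : mor A M) (b : mor M B) (d : mor B (susp A))
         (A' B' : C) (a' : mor A' M) (b' : mor M B') (d' : mor B' (susp A')),
    [/\ weight_decomposition n a b d,
        weight_decomposition (m - 1) a' b' d'
      & b' \oc a = 0].

Definition left_degenerate (M : C) : Prop := forall i : int, wge i M.
Definition right_degenerate (M : C) : Prop := forall i : int, wle i M.

Definition essentially_positive (M : C) : Prop :=
  exists M' A B : C,
    [/\ retract_of M M', right_degenerate A, wge 0 B & extension_of B A M'].

Definition essentially_negative (M : C) : Prop :=
  exists M' A B : C,
    [/\ retract_of M M', wle 0 A, left_degenerate B & extension_of B A M'].

End Weights.

Section WeightExact.
Variables (C C' : triangulated) (w : weight_structure C).
Variables (w' : weight_structure C') (F : exact_functor C C').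

Definition weight_exact : Prop :=
  (forall X, wle0 w X -> wle0 w' (F X)) /\
  (forall X, wge0 w X -> wge0 w' (F X)).

Hypothesis Fw : weight_exact.

Fact weight_exact_heart (X : C) : weq w 0 X -> weq w' 0 (F X).
Proof.
have isoF (Y : C) : X ~= Y -> F X ~= F Y.
  move=> [f [g [gf fg]]]; exists (fmap F f), (fmap F g).
  by rewrite -!fmapM gf fg !fmap1.
case: Fw => Fle Fge [[Y [hY iY]] [Z [hZ iZ]]]; split.
  by exists (F Y); split; [exact: Fge | exact: isoF].
by exists (F Z); split; [exact: Fle | exact: isoF].
Qed.

Definition heart_functor : functor (heart w) (heart w') :=
  @Functor (heart w) (heart w')
    (fun X => exist _ (F (sval X)) (weight_exact_heart (svalP X)))
    (fun X Y f => fmap F f) (fun X => fmap1 F (sval X))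
    (fun X Y Z g f => fmapM F g f) (fun X Y f f' => fmapD F f f').

End WeightExact.

Record complex (A : preadditive) := Complex {
  cpx_ob :> int -> A;
  cpx_d : forall i, mor (cpx_ob i) (cpx_ob (i + 1));
  cpx_dd : forall i, cpx_d (i + 1) \oc cpx_d i = 0
}.

Record chain_map (A : preadditive) (K L : complex A) := ChainMap {
  chain_fun :> forall i, mor (K i) (L i);
  chain_funP : forall i, cpx_d L i \oc chain_fun i = chain_fun (i + 1) \oc cpx_d K i
}.

Section Homotopy.
Variable A : preadditive.

Definition cpx_diff (K : complex A) (i j : int) (e : i + 1 = j) : mor (K i) (K j) :=
  ecast j (mor (K i) (K j)) e (cpx_d K i).

(* The homotopy has components h i : K^(i+1) -> L^i, and the homotopy relation
   is stated in degree i+1, so that all indices match definitionally. *)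
Definition homotopic (K L : complex A) (f g : forall i, mor (K i) (L i)) : Prop :=
  exists h : forall i, mor (K (i + 1)) (L i),
    forall i, f (i + 1) - g (i + 1) = cpx_d L i \oc h i + h (i + 1) \oc cpx_d K (i + 1).

(* K is isomorphic to the zero complex in the homotopy category K(A). *)
Definition zero_in_homotopy_category (K : complex A) : Prop :=
  exists (Z : complex A) (f : chain_map K Z) (g : chain_map Z K),
    [/\ forall i, is_zero_object (Z i),
        homotopic (fun i => g i \oc f i) (fun i => idm (K i))
      & homotopic (fun i => f i \oc g i) (fun i => idm (Z i))].

End Homotopy.

Fact opp_succ (n : int) : - (n + 1) + 1 = - n.
Proof. by rewrite opprD addrNK. Qed.

(* A choice of the weight complex t(M), together with the data it is built
   from; [wc_p] and [wc_q] are the last two maps of the triangles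
   w_{<=n} M -> w_{<=n+1} M -> M^(-n-1)[n+1] -> (w_{<=n} M)[1]. *)
Record weight_complex (C : triangulated) (w : weight_structure C) (M : C) :=
    WeightComplex {
  wc_cpx :> complex (heart w);
  wc_le : int -> C;
  wc_ge : int -> C;
  wc_c : forall n, mor (wc_le n) M;
  wc_r : forall n, mor M (wc_ge n);
  wc_b : forall n, mor (wc_ge n) (susp (wc_le n));
  wc_dec : forall n, weight_decomposition w n (wc_c n) (wc_r n) (wc_b n);
  wc_g : forall n, mor (wc_le n) (wc_le (n + 1));
  wc_gP : forall n, wc_c (n + 1) \oc wc_g n = wc_c n;
  wc_p : forall n, mor (wc_le n) (shift C n (sval (wc_cpx (- n))));
  wc_q : forall n,
    mor (shift C (n + 1) (sval (wc_cpx (- (n + 1))))) (susp (wc_le n));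
  wc_tri : forall n, dist (wc_g n) (wc_p (n + 1)) (wc_q n);
  wc_diff : forall n,
    fmap (shift C (n + 1)) (cpx_diff wc_cpx (opp_succ n))
      = shiftS n (sval (wc_cpx (- n))) \oc (fmap susp (wc_p n) \oc wc_q n)
}.

(* Every object has a weight complex, unique up to homotopy equivalence, so it
   does not matter which one is tested. *)
Definition w_degenerate (C : triangulated) (w : weight_structure C) (M : C) : Prop :=
  exists t : weight_complex w M, zero_in_homotopy_category t.

(* Main.v *)
Require Import Defs.
From mathcomp Require Import all_boot all_order ssralg ssrnum ssrint zify.
From Stdlib Require Import IndefiniteDescription.

Set Implicit Arguments.
Unset Strict Implicit.
Unset Printing Implicit Defensive.

Import Order.TTheory GRing.Theory Num.Theory.
Local Open Scope ring_scope.

(** The four properties are all expressed through one choice-free condition.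
    Say that [M] has no weight [n] ([no_weight]) if every composite
    [A -> M -> B] with [A] of weights [<= n] and [B] of weights [>= n] vanishes.
    Then
    - [M] is without weights [m], ..., [n] iff it has no weight [i] for each [i]
      between [m] and [n] ([without_weightsP]);
    - [M] is w-degenerate iff it has no weight at all ([w_degenerateP]);
    - [M] is essentially positive iff it has no negative weight
      ([essentially_positiveP]), essentially negative iff it has no positive
      one ([essentially_negativeP]).
    So it is enough that [F] reflects the absence of a single weight
    ([no_weight_reflect]).

    For the reflection, let [N] be the term of the weight complex of [M] that
    sits in weight [n], [u : w_{<=n} M -> N] and [v : N -> w_{>=n} M] the maps of
    the octahedron, [d] and [d'] the differentials into and out of [N].  As
    [v u] is the composite [w_{<=n} M -> M -> w_{>=n} M], [M] has no weight [n]
    iff [v u = 0], and orthogonality shows that this happens iff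
    [id_N = d rho + tau d'] for some [rho] and [tau]
    ([contraction_of_no_weight]).  It is already sufficient that
    [id_N - d rho - tau d'] is nilpotent ([no_weight_of_contraction]): since
    [v d = 0], [d' u = 0] and [d' d = 0], composing with this endomorphism, any
    number of times, between [u] and [v] leaves [v u] unchanged.  If [F M] has no
    weight [n], there are [rho'] and [tau'] for [F]; fullness of the functor on
    hearts lifts them to [rho] and [tau], the endomorphism
    [id_N - d rho - tau d'] is killed by [F], hence nilpotent, and [M] has no
    weight [n].

    A complex whose identity is [d rho + tau d'] in each degree separately is
    contractible ([degreewise_contractible_zero]), which gives the criterion for
    degenerate objects.

    For essential positivity, take [f : A -> M] with [A = w_{<=-1} M].  If no
    negative weight occurs, [f] factors through [w_{<=k} M] for every [k], and
    this yields an idempotent [e] of [A] with [f e = f] that kills all maps from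
    [A] to objects with weights bounded below.  Its image, if it existed, would
    be right degenerate with cofibre over [M] in weights [>= 0].  It need not
    exist, but the cone [D] of [id - e] always does and plays the role of the
    image plus its suspension, so that [D] maps to [M + M[1]], of which [M] is a
    retract.  The negative case is dual, with [D -> B] the fibre of [id - e] and
    [M + M[-1] -> D]. *)

Local Notation "f ^[1]" := (fmap susp f) (at level 2, format "f ^[1]").

(** * Preadditive categories *)

Section PreadditiveTheory.
Variable A : preadditive.

Lemma comp0m (X Y Z : A) (f : mor X Y) : (0 : mor Y Z) \oc f = 0.
Proof. by apply: (@addrI _ (0 \oc f)); rewrite -compmDl !addr0. Qed.

Lemma compm0 (X Y Z : A) (g : mor Y Z) : g \oc (0 : mor X Y) = 0.
Proof. by apply: (@addrI _ (g \oc 0)); rewrite -compmDr !addr0. Qed.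

Lemma compNm (X Y Z : A) (g : mor Y Z) (f : mor X Y) : (- g) \oc f = - (g \oc f).
Proof. by apply: (@addrI _ (g \oc f)); rewrite -compmDl !subrr comp0m. Qed.

Lemma compmN (X Y Z : A) (g : mor Y Z) (f : mor X Y) : g \oc (- f) = - (g \oc f).
Proof. by apply: (@addrI _ (g \oc f)); rewrite -compmDr !subrr compm0. Qed.

Lemma compmBl (X Y Z : A) (g g' : mor Y Z) (f : mor X Y) :
  (g - g') \oc f = g \oc f - g' \oc f.
Proof. by rewrite compmDl compNm. Qed.

Lemma compmBr (X Y Z : A) (g : mor Y Z) (f f' : mor X Y) :
  g \oc (f - f') = g \oc f - g \oc f'.
Proof. by rewrite compmDr compmN. Qed.

Lemma id_is_iso (X : A) : is_iso (idm X).
Proof. by exists (idm X); rewrite comp1m. Qed.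

Lemma opp_id_is_iso (X : A) : is_iso (- idm X).
Proof. by exists (- idm X); rewrite compNm compmN opprK comp1m. Qed.

Lemma iso_comp (X Y Z : A) (g : mor Y Z) (f : mor X Y) :
  is_iso g -> is_iso f -> is_iso (g \oc f).
Proof.
move=> [g' [g'g gg']] [f' [f'f ff']]; exists (f' \oc g'); split.
  by rewrite -compmA [g' \oc _]compmA g'g comp1m.
by rewrite -compmA [f \oc _]compmA ff' comp1m.
Qed.

Lemma iso_monic (X Y Z : A) (i : mor Y Z) (f g : mor X Y) :
  is_iso i -> i \oc f = i \oc g -> f = g.
Proof.
by move=> [j [ji _]] /(congr1 (compm j)); rewrite !compmA ji !comp1m.
Qed.

Lemma iso_epic (X Y Z : A) (i : mor X Y) (f g : mor Y Z) :
  is_iso i -> f \oc i = g \oc i -> f = g.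
Proof.
by move=> [j [_ ij]] /(congr1 (fun h => h \oc j)); rewrite -!compmA ij !compm1.
Qed.

Lemma isomorphic_refl (X : A) : X ~= X.
Proof. by exists (idm X); apply: id_is_iso. Qed.

Lemma isomorphic_sym (X Y : A) : X ~= Y -> Y ~= X.
Proof. by move=> [f [g [gf fg]]]; exists g, f. Qed.

Lemma isomorphic_trans (Y X Z : A) : X ~= Y -> Y ~= Z -> X ~= Z.
Proof. by move=> [f If] [g Ig]; exists (g \oc f); apply: iso_comp. Qed.

Lemma isomorphic_retract (X Y : A) : X ~= Y -> retract_of X Y.
Proof. by move=> [f [g [gf _]]]; exists f, g. Qed.

Lemma iter_comp (X : A) (e : mor X X) k :
  iter k.+1 (compm e) (idm X) = iter k (compm e) (idm X) \oc e.
Proof.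
elim: k => [|k IH]; first by rewrite /= compm1 comp1m.
by rewrite [LHS]iterS [in LHS]IH compmA.
Qed.

Lemma zero_object_of_id (Z : A) : idm Z = 0 -> is_zero_object Z.
Proof.
by move=> z; split=> X f; rewrite -1?[f]comp1m -1?[f]compm1 z ?comp0m ?compm0.
Qed.

Lemma nilpotent_conj (X Y : A) (i : mor X Y) (j : mor Y X) e :
  j \oc i = idm X -> i \oc j = idm Y ->
  nilpotent_endo (i \oc e \oc j) -> nilpotent_endo e.
Proof.
move=> ji ij [k Ek]; exists k.
have E : iter k (compm (i \oc e \oc j)) (idm Y) = i \oc iter k (compm e) (idm X) \oc j.
  elim: k {Ek} => [|k IH]; first by rewrite /= compm1 ij.
  by rewrite [LHS]iterS IH !compmA -[_ \oc j \oc i]compmA ji compm1 -[_ \oc e \oc _]compmA.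
have := congr1 (fun h => j \oc h \oc i) (etrans (esym E) Ek).
by rewrite compm0 comp0m !compmA ji comp1m -compmA ji compm1.
Qed.

(** In a complex [P -> N -> R] with [d] followed by [d'], the endomorphism
    [E = id - d rho - tau d'] is homotopic to the identity, and so are its
    powers: [v E^k] differs from [v] by a multiple of [d'], which [u]
    annihilates. *)
Lemma null_of_nilpotent (X N Y P R : A) (u : mor X N)
    (v : mor N Y) (d : mor P N) (d' : mor N R) (rho : mor N P) (tau : mor R N) k :
    v \oc d = 0 -> d' \oc u = 0 -> d' \oc d = 0 ->
    iter k (compm (idm N - d \oc rho - tau \oc d')) (idm N) = 0 ->
  v \oc u = 0.
Proof.
move=> vd d'u d'd; set E := _ - _.
have EK j : exists th, v \oc iter j (compm E) (idm N) = v + th \oc d'.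
  elim: j => [|j [th IH]]; first by exists 0; rewrite compm1 comp0m addr0.
  exists (th \oc (idm R - d' \oc tau) - v \oc tau).
  rewrite iter_comp compmA IH compmDl /E !(compmBl, compmBr) !compm1 !compmA vd.
  rewrite -[th \oc d' \oc d]compmA d'd compm0 !comp0m !subr0.
  by rewrite -[LHS]addrA; congr (_ + _); rewrite addrC.
have [th] := EK k; move=> /[swap] ->; rewrite compm0 => E0.
have -> : v = - (th \oc d') by apply/eqP; rewrite -addr_eq0 -E0.
by rewrite compNm -compmA d'u compm0 oppr0.
Qed.

End PreadditiveTheory.

Section FunctorTheory.
Variables (A B : preadditive) (F : functor A B).

Lemma fmap0 (X Y : A) : fmap F (0 : mor X Y) = 0.
Proof. by apply: (@addrI _ (fmap F 0)); rewrite -fmapD !addr0. Qed.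

Lemma fmapN (X Y : A) (f : mor X Y) : fmap F (- f) = - fmap F f.
Proof. by apply: (@addrI _ (fmap F f)); rewrite -fmapD !subrr fmap0. Qed.

Lemma fmapB (X Y : A) (f g : mor X Y) : fmap F (f - g) = fmap F f - fmap F g.
Proof. by rewrite fmapD fmapN. Qed.

Lemma fmap_iso (X Y : A) (f : mor X Y) : is_iso f -> is_iso (fmap F f).
Proof. by move=> [g [gf fg]]; exists (fmap F g); rewrite -!fmapM gf fg !fmap1. Qed.

Lemma fmap_isomorphic (X Y : A) : X ~= Y -> F X ~= F Y.
Proof. by move=> [f If]; exists (fmap F f); apply: fmap_iso. Qed.

Lemma fmap_iter (X : A) (e : mor X X) k :
  fmap F (iter k (compm e) (idm X)) = iter k (compm (fmap F e)) (idm (F X)).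
Proof. by elim: k => [|k /= <-]; rewrite ?fmap1 ?fmapM. Qed.

Definition faithful : Prop :=
  forall (X Y : A) (f g : mor X Y), fmap F f = fmap F g -> f = g.

Lemma fmap_zero_object Z : is_zero_object Z -> is_zero_object (F Z).
Proof. by move=> [_ z]; apply: zero_object_of_id; rewrite -fmap1 (z _ (idm Z)) fmap0. Qed.

Lemma full_faithful_iso : full F -> faithful ->
  forall X Y, F X ~= F Y -> X ~= Y.
Proof.
move=> Ff Fi X Y [f [g [gf fg]]].
have [[f' Ef] [g' Eg]] := (Ff X Y f, Ff Y X g).
by exists f', g'; split; apply: Fi; rewrite fmapM fmap1 Ef Eg.
Qed.

End FunctorTheory.

Lemma comp_full (A B D : preadditive) (G : functor B D) (F : functor A B) :
  full G -> full F -> full (compF G F).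
Proof. by move=> Gf Ff X Y g; have [h <-] := Gf _ _ g; have [f <-] := Ff _ _ h; exists f. Qed.

Lemma comp_faithful (A B D : preadditive) (G : functor B D) (F : functor A B) :
  faithful G -> faithful F -> faithful (compF G F).
Proof. by move=> Gi Fi X Y f g /Gi/Fi. Qed.

(** * Triangles *)

Section TriangleTheory.
Variable C : triangulated.

Lemma susp_faithful : faithful (@susp C).
Proof.
move=> X Y f g E; apply: (iso_monic (susp_unit_iso Y)).
by rewrite !susp_unit_nat E.
Qed.

Lemma desusp_faithful : faithful (@desusp C).
Proof.
move=> X Y f g E; apply: (iso_epic (susp_counit_iso X)).
by rewrite !susp_counit_nat E.
Qed.

Lemma susp_full : full (@susp C).
Proof.
move=> X Y g; have [j [jU Uj]] := susp_unit_iso Y.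
exists (j \oc (fmap desusp g \oc susp_unit X)); apply: desusp_faithful.
by apply: (iso_epic (susp_unit_iso X)); rewrite -susp_unit_nat compmA Uj comp1m.
Qed.

Lemma desusp_full : full (@desusp C).
Proof.
move=> X Y g; have [j [jU Uj]] := susp_counit_iso X.
exists ((susp_counit Y \oc fmap susp g) \oc j); apply: susp_faithful.
by apply: (iso_monic (susp_counit_iso Y)); rewrite -susp_counit_nat -compmA jU compm1.
Qed.

Lemma susp_surj (X : C) : exists Y : C, susp Y ~= X.
Proof. by exists (desusp X), (susp_counit X); apply: susp_counit_iso. Qed.

Lemma susp_reflects_iso (X Y : C) : susp X ~= susp Y -> X ~= Y.
Proof. exact: full_faithful_iso susp_full susp_faithful _ _. Qed.

Lemma susp_eq0 (X Y : C) (f : mor X Y) : f^[1] = 0 -> f = 0.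
Proof. by move=> f0; apply: susp_faithful; rewrite f0 fmap0. Qed.

Section OneTriangle.
Variables (X Y Z : C) (f : mor X Y) (g : mor Y Z) (h : mor Z (susp X)).
Hypothesis T : dist f g h.

Lemma dist_rot1 : dist g h (- f^[1]).
Proof. exact: (dist_rot _ _ _).1 T. Qed.

(** The triangle [W = W -> 0] maps to [X -> Y -> Z]: the axiom on maps of
    triangles produces a third map only, so both triangles are rotated once to
    put the missing map in last position. *)
Lemma dist_factor_left (W : C) (a : mor W Y) :
  g \oc a = 0 -> exists b : mor W X, f \oc b = a.
Proof.
move=> ga0; have [[O Oz] _] := tcat_additive C.
have W1 := (dist_rot _ _ _).1 (dist_id W Oz).
have [c [_ Ec]] := dist_map (a := a) (b := (0 : mor O Z)) W1 dist_rot1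
  (etrans (comp0m _ _) (esym ga0)).
have [b Eb] := susp_full c; exists b; apply: susp_faithful.
move: Ec; rewrite fmap1 compmN compm1 compNm -Eb fmapM.
by move/oppr_inj.
Qed.

Lemma dist_factor_right (W : C) (b : mor Y W) :
  b \oc f = 0 -> exists c : mor Z W, c \oc g = b.
Proof.
move=> bf0; have [[O Oz] _] := tcat_additive C.
have Oz1 : is_zero_object (susp O) := fmap_zero_object susp Oz.
have W1 : dist (0 : mor O W) (idm W) (0 : mor W (susp O)).
  apply/dist_rot; rewrite fmap0 oppr0; exact: dist_id.
have [c [Ec _]] := dist_map (a := (0 : mor X O)) (b := b) T W1
  (etrans bf0 (esym (comp0m _ _))).
by exists c; rewrite Ec comp1m.
Qed.

Lemma dist_comp0 : g \oc f = 0.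
Proof.
have [[O Oz] _] := tcat_additive C.
have [c [Ec _]] := dist_map (a := idm X) (b := f) (dist_id X Oz) T erefl.
by rewrite -Ec compm0.
Qed.

End OneTriangle.

Section OneTriangleRotated.
Variables (X Y Z : C) (f : mor X Y) (g : mor Y Z) (h : mor Z (susp X)).
Hypothesis T : dist f g h.

Lemma dist_comp1 : h \oc g = 0.
Proof. exact: dist_comp0 (dist_rot1 T). Qed.

Lemma dist_comp2 : f^[1] \oc h = 0.
Proof.
by apply: oppr_inj; rewrite oppr0 -compNm (dist_comp0 (dist_rot1 (dist_rot1 T))).
Qed.

Lemma dist_factor_left1 (W : C) (a : mor W Z) :
  h \oc a = 0 -> exists b : mor W Y, g \oc b = a.
Proof. exact: dist_factor_left (dist_rot1 T) _ _. Qed.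

Lemma dist_factor_right1 (W : C) (b : mor Z W) :
  b \oc g = 0 -> exists c : mor (susp X) W, c \oc h = b.
Proof. exact: dist_factor_right (dist_rot1 T) _ _. Qed.

Lemma dist_factor_left2 (W : C) (a : mor W (susp X)) :
  f^[1] \oc a = 0 -> exists b : mor W Z, h \oc b = a.
Proof.
move=> fa0; apply: (dist_factor_left (dist_rot1 (dist_rot1 T))).
by rewrite compNm fa0 oppr0.
Qed.

Lemma dist_factor_right2 (W : C) (b : mor X W) :
  b^[1] \oc h = 0 -> exists c : mor Y W, c \oc f = b.
Proof.
move=> bh0; have [c Ec] := dist_factor_right (dist_rot1 (dist_rot1 T)) bh0.
have [c' Ec'] := susp_full c; exists (- c'); apply: susp_faithful.
by rewrite fmapM fmapN Ec' compNm -compmN.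
Qed.

(** The rotation of a triangle three times changes the sign of all three maps;
    an automorphism [- id] of the middle vertex moves the signs to the last. *)
Lemma dist_susp : dist f^[1] g^[1] (- h^[1]).
Proof.
have R := dist_rot1 (dist_rot1 (dist_rot1 T)).
apply: (dist_iso (id_is_iso _) (opp_id_is_iso _) (id_is_iso _) _ _ _ R).
- by rewrite compNm compmN opprK comp1m compm1.
- by rewrite !compmN compm1 comp1m.
- by rewrite fmap1 comp1m compm1.
Qed.

End OneTriangleRotated.

Lemma dist_desusp (X Y Z : C) (f : mor X Y) (g : mor Y Z) (h : mor Z (susp X)) :
  dist f^[1] g^[1] (- h^[1]) -> dist f g h.
Proof.
move=> T; do 3! apply: (dist_rot _ _ _).2.
apply: (dist_iso (id_is_iso _) (opp_id_is_iso _) (id_is_iso _) _ _ _ T).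
- by rewrite !compNm compm1 comp1m.
- by rewrite compNm compmN opprK compm1 comp1m.
- by rewrite fmap1 comp1m compm1.
Qed.

(** The suspension is only an equivalence, so the cone of [g] is replaced by an
    isomorphic suspension before the triangle is rotated back. *)
Lemma dist_fiber (Y Z : C) (g : mor Y Z) :
  exists X (f : mor X Y) (h : mor Z (susp X)), dist f g h.
Proof.
have [W [h [k T]]] := dist_cone g.
have [X [i Ii]] := susp_surj W; have [j [ji ij]] := Ii.
have [f Ef] := susp_full (- (k \oc i)); exists X, f, (j \oc h).
apply/dist_rot; rewrite Ef opprK.
apply: (dist_iso (id_is_iso _) (id_is_iso _) (c := j) _ _ _ _ T).
- by exists i.
- by rewrite comp1m compm1.
- by rewrite compm1.
- by rewrite fmap1 comp1m -compmA ij compm1.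
Qed.

End TriangleTheory.

(** * Shifts *)

Section ShiftTheory.
Variable C : triangulated.

Lemma shift_full_faithful (n : int) : full (shift C n) /\ faithful (shift C n).
Proof.
have idff : full (idF C) /\ faithful (idF C) by split=> [X Y g|X Y f g] //; exists g.
have iterff (G : functor C C) : full G -> faithful G ->
    forall k, full (iterF k G) /\ faithful (iterF k G).
  move=> Gf Gi; elim=> [//|k [kf ki]].
  by split; [exact: comp_full | exact: comp_faithful].
by case: n => k; apply: iterff; do ?[exact: susp_full | exact: susp_faithful
  | exact: desusp_full | exact: desusp_faithful].
Qed.

Lemma shiftS_iso (n : int) (X : C) : is_iso (shiftS n X).
Proof.
case: n => [n|[|k]]; rewrite /shiftS; last 2 first.
- exact: susp_counit_iso.
- case: _ / (shift_succ_neg k); exact: susp_counit_iso.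
by case: _ / (shift_succ_pos n); exact: id_is_iso.
Qed.

Lemma shiftS_nat (n : int) (X Y : C) (f : mor X Y) :
  fmap (shift C (n + 1)) f \oc shiftS n X = shiftS n Y \oc (fmap (shift C n) f)^[1].
Proof.
case: n => [n|[|k]]; rewrite /shiftS; last 2 first.
- exact: susp_counit_nat.
- case: _ / (shift_succ_neg k); exact: susp_counit_nat.
by case: _ / (shift_succ_pos n); rewrite compm1 comp1m.
Qed.

(** Statements about weight [n] are proved in this way: they hold at [0] by the
    axioms, and the suspension makes the ones at [n] and [n + 1] equivalent. *)
Lemma int_ind_iff (P : int -> Prop) :
  P 0 -> (forall n, P n <-> P (n + 1)) -> forall n, P n.
Proof.
move=> P0 PS; elim/int_rect=> [//|n /PS|n Pn]; first by rewrite -addn1 PoszD.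
by apply/PS; rewrite -addn1 PoszD opprD addrNK.
Qed.

Lemma shift_class_susp (P : C -> Prop) n (X : C) :
  shift_class P (n + 1) (susp X) <-> shift_class P n X.
Proof.
have iS Y : susp (shift C n Y) ~= shift C (n + 1) Y.
  by exists (shiftS n Y); apply: shiftS_iso.
split=> [] [Y [PY I]]; exists Y; split=> //; last first.
  exact: isomorphic_trans (fmap_isomorphic susp I) (iS Y).
exact/susp_reflects_iso/(isomorphic_trans I)/isomorphic_sym/iS.
Qed.

Lemma shift_class_iso (P : C -> Prop) n (X Y : C) :
  X ~= Y -> shift_class P n Y -> shift_class P n X.
Proof.
by move=> I [Z [PZ J]]; exists Z; split=> //; apply: isomorphic_trans I J.
Qed.

Section RetractClosed.
Variable P : C -> Prop.
Hypothesis P_retract : forall X Y, retract_of X Y -> P Y -> P X.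

Lemma shift_class0 X : shift_class P 0 X <-> P X.
Proof.
split=> [[Y [PY I]]|PX]; first exact: P_retract (isomorphic_retract I) PY.
by exists X; split=> //; apply: isomorphic_refl.
Qed.

Lemma shift_class_retract n X Y :
  retract_of X Y -> shift_class P n Y -> shift_class P n X.
Proof.
move: n X Y; apply: int_ind_iff => [X Y r /shift_class0 PY|n].
  by apply/shift_class0; apply: P_retract r PY.
split=> IH X Y [i [p pi]] hY; last first.
  apply: (shift_class_susp _ _ _).1; apply: (IH _ (susp Y)).
    by exists i^[1], p^[1]; rewrite -fmapM pi fmap1.
  exact: (shift_class_susp _ _ _).2.
have [X' [j [k [kj jk]]]] := susp_surj X; have [Y' [l [m [ml lm]]]] := susp_surj Y.
apply: (@shift_class_iso _ _ _ (susp X')); first by exists k, j.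
apply: (shift_class_susp _ _ _).2; apply: (IH _ Y'); last first.
  by apply: (shift_class_susp _ _ _).1; apply: shift_class_iso hY; exists l, m.
have [i' Ei] := susp_full (m \oc i \oc j); have [p' Ep] := susp_full (k \oc p \oc l).
exists i', p'; apply: susp_faithful; rewrite fmapM Ei Ep fmap1.
by rewrite !compmA -[_ \oc l \oc m]compmA lm compm1 -[_ \oc p \oc i]compmA pi compm1.
Qed.

End RetractClosed.

End ShiftTheory.

Lemma shift_class_image (C C' : triangulated) (F : exact_functor C C')
    (P : C -> Prop) (P' : C' -> Prop) n X :
  (forall Y, P Y -> P' (F Y)) -> shift_class P n X -> shift_class P' n (F X).
Proof.
move=> PF; have iF Y : F (susp Y) ~= susp (F Y).
  by exists (efun_susp F Y); apply: efun_susp_iso.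
move: n X; apply: int_ind_iff => [X [Y [PY I]]|n].
  by exists (F Y); split; [apply: PF | apply: fmap_isomorphic I].
split=> IH X hX.
  have [Y I] := susp_surj X.
  apply: shift_class_iso (fmap_isomorphic F (isomorphic_sym I)) _.
  apply: shift_class_iso (iF Y) _; apply: (shift_class_susp _ _ _).2; apply: IH.
  by apply: (shift_class_susp _ _ _).1; apply: shift_class_iso I hX.
apply: (shift_class_susp _ _ _).1; apply: shift_class_iso (isomorphic_sym (iF X)) _.
by apply: IH; apply: (shift_class_susp _ _ _).2.
Qed.

(** * Weights *)

Section WeightTheory.
Variables (C : triangulated) (w : weight_structure C).

Lemma wle_susp n X : wle w (n + 1) (susp X) <-> wle w n X.
Proof. exact: shift_class_susp. Qed.

Lemma wge_susp n X : wge w (n + 1) (susp X) <-> wge w n X.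
Proof. exact: shift_class_susp. Qed.

Lemma weq_susp n X : weq w (n + 1) (susp X) <-> weq w n X.
Proof. by rewrite /weq wle_susp wge_susp. Qed.

Lemma wle_iso n X Y : X ~= Y -> wle w n Y -> wle w n X.
Proof. exact: shift_class_iso. Qed.

Lemma wge_iso n X Y : X ~= Y -> wge w n Y -> wge w n X.
Proof. exact: shift_class_iso. Qed.

Lemma weq_iso n X Y : X ~= Y -> weq w n Y -> weq w n X.
Proof. by move=> I [h1 h2]; split; [exact: wge_iso I _ | exact: wle_iso I _]. Qed.

Lemma wle0E X : wle w 0 X <-> wle0 w X.
Proof. exact/shift_class0/wle0_retract. Qed.

Lemma wge0E X : wge w 0 X <-> wge0 w X.
Proof. exact/shift_class0/wge0_retract. Qed.

Lemma orth n X Y (f : mor X Y) : wle w n X -> wge w (n + 1) Y -> f = 0.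
Proof.
move: n X Y f; apply: int_ind_iff => [X Y f /wle0E hX hY|n]; first exact: weight_orth hX hY.
split=> IH X Y f hX hY; last first.
  by apply: susp_eq0; apply: IH; [exact: (wle_susp _ _).2 | exact: (wge_susp _ _).2].
have [[X' [i Ii]] [Y' [j Ij]]] := (susp_surj X, susp_surj Y).
have [i' [i'i ii']] := Ii; have [j' [j'j jj']] := Ij.
have [f' Ef] := susp_full (j' \oc (f \oc i)).
have f0 : f' = 0.
  apply: IH.
    by apply: (wle_susp _ _).1; apply: wle_iso hX; exists i.
  by apply: (wge_susp _ _).1; apply: wge_iso hY; exists j.
apply: (iso_epic Ii); apply: (@iso_monic _ _ _ _ j'); first by exists j.
by rewrite -Ef f0 fmap0 comp0m compm0.
Qed.

Lemma wge_pred n X : wge w (n + 1) X -> wge w n X.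
Proof.
move: n X; apply: int_ind_iff => [X /wge0_shift hX|n]; first exact/wge0E.
split=> IH X hX; last by apply: (wge_susp _ _).1; apply: IH; apply: (wge_susp _ _).2.
have [Y I] := susp_surj X; apply: wge_iso (isomorphic_sym I) _.
by apply: (wge_susp _ _).2; apply: IH; apply: (wge_susp _ _).1; apply: wge_iso I hX.
Qed.

Lemma wge_weaken (m n : int) X : m <= n -> wge w n X -> wge w m X.
Proof.
move=> mn; have -> : n = m + `|n - m|%N by lia.
elim: `|n - m|%N => [|k IH]; first by rewrite addr0.
by rewrite -addn1 PoszD addrA => /wge_pred.
Qed.

Lemma orth_lt (m n : int) X Y (f : mor X Y) : m < n -> wle w m X -> wge w n Y -> f = 0.
Proof. by move=> mn hX hY; apply: (orth f hX); apply: wge_weaken hY; lia. Qed.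

Lemma weight_decomposition_exists n M : exists A B a b d,
  @weight_decomposition C w n M A B a b d.
Proof.
move: n M; apply: int_ind_iff => [M|n].
  have [A [B [a [b [d [T hA hB]]]]]] := weight_dec w M.
  by exists A, B, a, b, d; split=> //; apply/wle0E.
split=> IH M.
  have [M' [i Ii]] := susp_surj M; have [j [ji ij]] := Ii.
  have [A [B [a [b [d [T hA hB]]]]]] := IH M'.
  exists (susp A), (susp B), (i \oc a^[1]), (b^[1] \oc j), (- d^[1]).
  split; [|exact: (wle_susp _ _).2|exact: (wge_susp _ _).2].
  apply: (dist_iso (id_is_iso _) Ii (id_is_iso _) _ _ _ (dist_susp T)).
  - by rewrite compm1.
  - by rewrite -compmA ji comp1m compm1.
  - by rewrite fmap1 comp1m compm1.
have [A [B [a [b [d [T hA hB]]]]]] := IH (susp M).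
have [[A' [i Ii]] [B' [j Ij]]] := (susp_surj A, susp_surj B).
have [i' [i'i ii']] := Ii; have [j' [j'j jj']] := Ij.
have [a' Ea] := susp_full (a \oc i).
have [b' Eb] := susp_full (j' \oc b).
have [d' Ed] := susp_full (- (i'^[1] \oc (d \oc j))).
exists A', B', a', b', d'; split; last 2 first.
- by apply: (wle_susp _ _).1; apply: wle_iso hA; exists i.
- by apply: (wge_susp _ _).1; apply: wge_iso hB; exists j.
apply: dist_desusp; rewrite Ea Eb Ed opprK.
apply: (dist_iso (a := i') (b := idm _) (c := j') _ _ _ _ _ _ T).
- by exists i.
- exact: id_is_iso.
- by exists j.
- by rewrite comp1m -compmA ii' compm1.
- by rewrite compm1.
- by rewrite -!compmA jj' compm1.
Qed.

Lemma wle_retract n X Y : retract_of X Y -> wle w n Y -> wle w n X.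
Proof. exact/shift_class_retract/wle0_retract. Qed.

Lemma wge_retract n X Y : retract_of X Y -> wge w n Y -> wge w n X.
Proof. exact/shift_class_retract/wge0_retract. Qed.

(** If [w_{<=n} Y -> Y] is zero, then [Y] is a retract of [w_{>=n+1} Y]. *)
Lemma wge_of_orth n Y :
  (forall X (f : mor X Y), wle w n X -> f = 0) -> wge w (n + 1) Y.
Proof.
move=> Y0; have [A [B [a [b [d [T hA hB]]]]]] := weight_decomposition_exists n Y.
have a0 : idm Y \oc a = 0 by rewrite (Y0 _ a hA) compm0.
have [c Ec] := dist_factor_right T a0.
by apply: wge_retract hB; exists b, c.
Qed.

Lemma wle_of_orth n X :
  (forall Y (f : mor X Y), wge w (n + 1) Y -> f = 0) -> wle w n X.
Proof.
move=> X0; have [A [B [a [b [d [T hA hB]]]]]] := weight_decomposition_exists n X.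
have b0 : b \oc idm X = 0 by rewrite (X0 _ b hB) comp0m.
have [c Ec] := dist_factor_left T b0.
by apply: wle_retract hA; exists c, a.
Qed.

Lemma wle_ext n X Y Z (f : mor X Y) (g : mor Y Z) h :
  dist f g h -> wle w n X -> wle w n Z -> wle w n Y.
Proof.
move=> T hX hZ; apply: wle_of_orth => W x hW.
have [y <-] := dist_factor_right T (orth (x \oc f) hX hW).
by rewrite (orth y hZ hW) comp0m.
Qed.

(** * Objects without a given weight *)

(** Being without weights [n], ..., [n], phrased without a choice of weight
    decompositions: it then passes to retracts by composition. *)
Definition no_weight n M : Prop :=
  forall A B (a : mor A M) (b : mor M B), wle w n A -> wge w n B -> b \oc a = 0.

Lemma no_weight_retract n M M' : retract_of M M' -> no_weight n M' -> no_weight n M.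
Proof.
move=> [i [p pi]] h A B a b hA hB.
by rewrite -[a]comp1m -pi -compmA compmA (h _ _ (i \oc a) (b \oc p)).
Qed.

(** As [M] has no weight [n], a map from [A] to [M] becomes zero in
    [w_{>=n} M] and factors through [w_{<=n-1} M]; this lowers [n] until it
    reaches [m - 1], where orthogonality applies. *)
Lemma no_weight_range (m n : int) M :
    (forall i : int, m <= i <= n -> no_weight i M) -> m <= n + 1 ->
  forall A B (a : mor A M) (b : mor M B), wle w n A -> wge w m B -> b \oc a = 0.
Proof.
move=> hM mn; have [k En] : exists k : nat, n = m - 1 + k%:Z.
  by exists `|(n - (m - 1))%R|%N; lia.
elim: k n En hM {mn} => [|k IH] n En hM A B a b hA hB.
  by apply: (@orth_lt n m _ _ _ _ hA hB); lia.
have [L [R [c [r [d [T hL hR]]]]]] := weight_decomposition_exists (n - 1) M.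
rewrite addrNK in hR.
have [x <-] := dist_factor_left T (hM n ltac:(lia) _ _ a r hA hR).
have En1 : n - 1 = m - 1 + k%:Z by lia.
have hM1 (i : int) : m <= i <= n - 1 -> no_weight i M by move=> hi; apply: hM; lia.
by rewrite compmA (IH _ En1 hM1 _ _ c b hL hB) comp0m.
Qed.

Lemma without_weightsP (m n : int) M : m <= n ->
  without_weights w m n M <-> (forall i : int, m <= i <= n -> no_weight i M).
Proof.
move=> mn; split; last first.
  move=> hM; have [A [B [a [b [d D]]]]] := weight_decomposition_exists n M.
  have [A' [B' [a' [b' [d' D']]]]] := weight_decomposition_exists (m - 1) M.
  exists A, B, a, b, d, A', B', a', b', d'; split=> //.
  case: D D' => [_ hA _] [_ _ hB'].
  by apply: no_weight_range hM _ _ _ _ _ hA _; [lia | move: hB'; rewrite addrNK].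
move=> [A [B [a [b [d [A' [B' [a' [b' [d' [[T hA hB] [T' hA' hB'] E]]]]]]]]]]].
move=> i /andP[mi ni] X Y x y hX hY.
have [lt_in lt_mi] : i < n + 1 /\ m - 1 < i by lia.
have [x' <-] := dist_factor_left T (orth_lt (b \oc x) lt_in hX hB).
have [y' <-] := dist_factor_right T' (orth_lt (y \oc a') lt_mi hA' hY).
by rewrite compmA -[y' \oc _ \oc _]compmA E compm0 comp0m.
Qed.

End WeightTheory.

(** * Weight towers *)

Lemma dep_choice (I : Type) (T : I -> Type) (P : forall i, T i -> Prop) :
  (forall i, exists x, P i x) -> exists f : forall i, T i, forall i, P i (f i).
Proof.
move=> h; pose cid i := constructive_indefinite_description _ (h i).
by exists (fun i => sval (cid i)) => i; apply: (svalP (cid i)).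
Qed.

(** The data from which a weight complex is built, with the layer
    [tw_layer n], of weight [n + 1], left where the triangle puts it instead of
    being shifted into the heart.  Unlike weight complexes, towers are mapped to
    towers by a weight-exact functor without any coherence with the shifts. *)
Record tower (C : triangulated) (w : weight_structure C) (M : C) := Tower {
  tw_le : int -> C;
  tw_ge : int -> C;
  tw_c : forall n, mor (tw_le n) M;
  tw_r : forall n, mor M (tw_ge n);
  tw_b : forall n, mor (tw_ge n) (susp (tw_le n));
  tw_dec : forall n, weight_decomposition w n (tw_c n) (tw_r n) (tw_b n);
  tw_g : forall n, mor (tw_le n) (tw_le (n + 1));
  tw_gP : forall n, tw_c (n + 1) \oc tw_g n = tw_c n;
  tw_layer : int -> C;
  tw_u : forall n, mor (tw_le (n + 1)) (tw_layer n);
  tw_q : forall n, mor (tw_layer n) (susp (tw_le n));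
  tw_tri : forall n, dist (tw_g n) (tw_u n) (tw_q n)
}.

Section TowerTheory.
Variables (C : triangulated) (w : weight_structure C).

Lemma tower_map_exists M n A B a b d A' B' a' b' d' :
    @weight_decomposition C w n M A B a b d ->
    @weight_decomposition C w (n + 1) M A' B' a' b' d' ->
  exists g : mor A A', a' \oc g = a.
Proof.
move=> [T hA hB] [T' hA' hB']; apply: (dist_factor_left T').
by apply: orth_lt hA hB'; lia.
Qed.

Lemma tower_exists M : inhabited (tower w M).
Proof.
have [A decA] := dep_choice (fun n => weight_decomposition_exists w n M).
have [B {}decA] := dep_choice decA; have [c {}decA] := dep_choice decA.
have [r {}decA] := dep_choice decA; have [b {}decA] := dep_choice decA.
have [g gP] := dep_choice (fun n => tower_map_exists (decA n) (decA (n + 1))).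
have [N triN] := dep_choice (fun n => dist_cone (g n)).
have [u {}triN] := dep_choice triN; have [q {}triN] := dep_choice triN.
exact: inhabits (Tower decA gP triN).
Qed.

Section OneTower.
Variables (M : C) (t : tower w M).

Lemma tw_leP n : wle w n (tw_le t n).
Proof. by case: (tw_dec t n). Qed.

Lemma tw_geP n : wge w (n + 1) (tw_ge t n).
Proof. by case: (tw_dec t n). Qed.

Lemma tw_dist n : dist (tw_c t n) (tw_r t n) (tw_b t n).
Proof. by case: (tw_dec t n). Qed.

(** The octahedron on [w_{<=n} M -> w_{<=n+1} M -> M]: the layer is also the
    fibre of [w_{>=n+1} M -> w_{>=n+2} M]. *)
Lemma tw_oct n : exists (v : mor (tw_layer t n) (tw_ge t n))
    (z : mor (tw_ge t n) (tw_ge t (n + 1))),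
  [/\ dist v z ((tw_u t n)^[1] \oc tw_b t (n + 1)),
      v \oc tw_u t n = tw_r t n \oc tw_c t (n + 1)
    & tw_b t n \oc v = tw_q t n].
Proof.
have T := tw_dist n; rewrite -(tw_gP t n) in T.
have [v [z [? [? ? ? ?]]]] := dist_oct (tw_tri t n) (tw_dist (n + 1)) T.
by exists v, z.
Qed.

(** The layer is an extension of objects of weights [<= n + 1], and a fibre
    between objects of weights [>= n + 1] and [>= n + 2]. *)
Lemma tw_layerP n : weq w (n + 1) (tw_layer t n).
Proof.
split; last first.
  exact: wle_ext (dist_rot1 (tw_tri t n)) (tw_leP _) ((wle_susp _ _ _).2 (tw_leP n)).
have [v [z [T _ _]]] := tw_oct n; apply: wge_of_orth => X x hX.
apply: susp_faithful; rewrite fmap0.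
have x0 : v^[1] \oc x^[1] = 0.
  by rewrite -fmapM (orth (v \oc x) hX (tw_geP n)) fmap0.
have [y <-] := dist_factor_left2 T x0.
by rewrite (orth y ((wle_susp _ _ _).2 hX) (tw_geP _)) compm0.
Qed.

Definition tw_d n : mor (tw_layer t (n + 1)) (susp (tw_layer t n)) :=
  (tw_u t n)^[1] \oc tw_q t (n + 1).

Lemma tw_dd n : (tw_d n)^[1] \oc tw_d (n + 1) = 0.
Proof.
rewrite /tw_d fmapM compmA -[_ \oc _ \oc (tw_u _ _)^[1]]compmA -fmapM.
by rewrite (dist_comp1 (tw_tri t (n + 1))) fmap0 compm0 comp0m.
Qed.

Lemma tw_d_u n : tw_d n \oc tw_u t (n + 1) = 0.
Proof. by rewrite /tw_d -compmA (dist_comp1 (tw_tri t (n + 1))) compm0. Qed.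

Lemma tw_rc_d n : (tw_r t n \oc tw_c t (n + 1))^[1] \oc tw_q t (n + 1) = 0.
Proof.
rewrite -(tw_gP t (n + 1)) compmA fmapM -compmA.
by rewrite (dist_comp2 (tw_tri t (n + 1))) compm0.
Qed.

Lemma no_weight_tower n :
  no_weight w (n + 1) M <-> tw_r t n \oc tw_c t (n + 1) = 0.
Proof.
split=> [h | h A B a b hA hB].
  by apply: (h _ _ _ _ (tw_leP _) (tw_geP _)).
have [x <-] := dist_factor_left (tw_dist (n + 1))
  (orth (tw_r t (n + 1) \oc a) hA (tw_geP _)).
have [y <-] := dist_factor_right (tw_dist n) (orth (b \oc tw_c t n) (tw_leP n) hB).
by rewrite compmA -[y \oc _ \oc _]compmA h compm0 comp0m.
Qed.

(** Let [u], [v] be the maps at the layer [N] with [v u = 0].  Then [u] comes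
    from the fibre of [v]; on an object of weights [<= n + 2] such a map factors
    through the next layer, and orthogonality extends the factor along [u] to
    [rho].  So [id - d rho] kills [u] and factors through the suspension of
    the previous stage, hence, again by weights, through the previous
    layer.  All maps are written one suspension up, since the differential
    [tw_d] ends in a suspension. *)
Lemma contraction_of_no_weight n : no_weight w (n + 1 + 1) M ->
  exists (rho : mor (susp (tw_layer t (n + 1))) (tw_layer t (n + 1 + 1)))
    (tau : mor (susp (tw_layer t n)) (tw_layer t (n + 1))),
  idm _ = tw_d (n + 1) \oc rho + (tau \oc tw_d n)^[1].
Proof.
move=> /no_weight_tower rc0.
have [v [z [Tv vu bv]]] := tw_oct (n + 1).
have [v' [z' [Tv' _ bv']]] := tw_oct (n + 1 + 1).
rewrite -vu in rc0.
have [y Ey] : exists y, (tw_u t (n + 1))^[1] \oc tw_b t (n + 1 + 1) \oc y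
    = (tw_u t (n + 1))^[1].
  by apply: (dist_factor_left2 Tv); rewrite -fmapM rc0 fmap0.
have [y' Ey'] := dist_factor_left Tv'
  (orth (z' \oc y) ((wle_susp _ _ _).2 (tw_leP _)) (tw_geP _)).
(* Both extensions below exist because the obstruction is a map from weights
   [<= k] to weights [>= k + 1]. *)
have [rho Er] := dist_factor_right (dist_susp (tw_tri t (n + 1)))
  (orth (y' \oc (tw_g t (n + 1))^[1]) ((wle_susp _ _ _).2 (tw_leP _))
     (tw_layerP _).1).
have Edr : tw_d (n + 1) \oc rho \oc (tw_u t (n + 1))^[1] = (tw_u t (n + 1))^[1].
  by rewrite -compmA Er -[RHS]Ey -Ey' /tw_d -bv' !compmA.
have [th Eth] := susp_full (idm _ - tw_d (n + 1) \oc rho).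
have th0 : th \oc tw_u t (n + 1) = 0.
  by apply: susp_faithful; rewrite fmapM Eth fmap0 compmBl comp1m Edr subrr.
have [x Ex] := dist_factor_right1 (tw_tri t (n + 1)) th0.
have [tau Et] := dist_factor_right (dist_susp (tw_tri t n))
  (orth (x \oc (tw_g t n)^[1]) ((wle_susp _ _ _).2 (tw_leP _)) (tw_layerP _).1).
exists rho, tau.
by rewrite [in RHS]/(tw_d n) compmA Et Ex Eth [RHS]addrC subrK.
Qed.

Lemma no_weight_of_contraction n
    (rho : mor (susp (tw_layer t (n + 1))) (tw_layer t (n + 1 + 1)))
    (tau : mor (susp (tw_layer t n)) (tw_layer t (n + 1))) :
  nilpotent_endo (idm _ - tw_d (n + 1) \oc rho - (tau \oc tw_d n)^[1]) ->
  no_weight w (n + 1 + 1) M.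
Proof.
move=> [k Ek]; apply/no_weight_tower.
have [v [z [Tv vu _]]] := tw_oct (n + 1).
rewrite -vu; apply: susp_faithful; rewrite fmap0 fmapM.
rewrite fmapM in Ek; apply: null_of_nilpotent Ek.
- by rewrite /tw_d compmA -fmapM vu tw_rc_d.
- by rewrite -fmapM tw_d_u fmap0.
- exact: tw_dd.
Qed.

End OneTower.
End TowerTheory.

(** * Transport along the functor *)

Section Transport.
Variables (C C' : triangulated) (w : weight_structure C) (w' : weight_structure C').
Variable F : exact_functor C C'.

Definition lifts (X Y : C) : Prop :=
  forall g : mor (F X) (F Y), exists f : mor X Y, fmap F f = g.

Definition nil_kernel (X : C) : Prop :=
  forall e : mor X X, fmap F e = 0 -> nilpotent_endo e.

Lemma lifts_iso X X' Y Y' : X ~= X' -> Y ~= Y' -> lifts X' Y' -> lifts X Y.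
Proof.
move=> [i [i' [i'i _]]] [j [j' [j'j _]]] L g.
have [f Ef] := L (fmap F j \oc g \oc fmap F i'); exists (j' \oc f \oc i).
rewrite !fmapM Ef !compmA -fmapM j'j fmap1 comp1m.
by rewrite -compmA -fmapM i'i fmap1 compm1.
Qed.

Lemma lifts_susp X Y : lifts (susp X) (susp Y) <-> lifts X Y.
Proof.
have [[p [pP Pp]] [q [qP Pq]]] := (efun_susp_iso F X, efun_susp_iso F Y).
split=> L g.
  have [f Ef] := L (q \oc g^[1] \oc efun_susp F X).
  have [f' Ef'] := susp_full f; exists f'; apply: susp_faithful.
  apply: (iso_epic (efun_susp_iso F X)).
  by rewrite -efun_susp_nat Ef' Ef !compmA Pq comp1m.
have [g' Eg'] := susp_full (efun_susp F Y \oc g \oc p).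
have [f Ef] := L g'; exists f^[1]; apply: (iso_monic (efun_susp_iso F Y)).
by rewrite efun_susp_nat Ef Eg' -compmA pP compm1.
Qed.

Lemma nil_kernel_iso X Y : X ~= Y -> nil_kernel Y -> nil_kernel X.
Proof.
move=> [i [j [ji ij]]] N e Fe; apply: (nilpotent_conj ji ij); apply: N.
by rewrite !fmapM Fe compm0 comp0m.
Qed.

Lemma nil_kernel_susp X : nil_kernel (susp X) <-> nil_kernel X.
Proof.
split=> N e Fe.
  have [|k Ek] := N e^[1].
    apply: (iso_monic (efun_susp_iso F X)).
    by rewrite efun_susp_nat Fe fmap0 comp0m compm0.
  by exists k; apply: susp_faithful; rewrite fmap_iter fmap0.
have [e' Ee] := susp_full e; have [|k Ek] := N e'.
  apply: susp_faithful; apply: (iso_epic (efun_susp_iso F X)).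
  by rewrite -efun_susp_nat Ee Fe fmap0 comp0m compm0.
by exists k; rewrite -Ee -fmap_iter Ek fmap0.
Qed.

Hypothesis Fw : weight_exact w w' F.

Lemma weight_exact_le n X : wle w n X -> wle w' n (F X).
Proof. exact/shift_class_image/Fw.1. Qed.

Lemma weight_exact_ge n X : wge w n X -> wge w' n (F X).
Proof. exact/shift_class_image/Fw.2. Qed.

Lemma tower_image_dec M (t : tower w M) n :
  weight_decomposition w' n (fmap F (tw_c t n)) (fmap F (tw_r t n))
    (efun_susp F _ \oc fmap F (tw_b t n)).
Proof.
have [T hA hB] := tw_dec t n; split; first exact: efun_dist.
  exact: weight_exact_le.
exact: weight_exact_ge.
Qed.

Lemma tower_image_c M (t : tower w M) n :
  fmap F (tw_c t (n + 1)) \oc fmap F (tw_g t n) = fmap F (tw_c t n).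
Proof. by rewrite -fmapM tw_gP. Qed.

Definition tower_image M (t : tower w M) : tower w' (F M) :=
  Tower (tower_image_dec t) (tower_image_c t) (fun n => efun_dist F (tw_tri t n)).

Lemma tower_image_d M (t : tower w M) n :
  tw_d (tower_image t) n = efun_susp F _ \oc fmap F (tw_d t n).
Proof. by rewrite /tw_d /= fmapM [RHS]compmA efun_susp_nat -compmA. Qed.

Hypothesis HF_full : full (heart_functor Fw).
Hypothesis HF_nil : forall (X : heart w) (e : mor X X),
  fmap (heart_functor Fw) e = 0 -> nilpotent_endo e.

(** The hypotheses on the hearts concern weight [0] only; suspending carries
    them to every weight. *)
Lemma weq_lifts n X Y : weq w n X -> weq w n Y -> lifts X Y.
Proof.
move: n X Y; apply: int_ind_iff => [X Y hX hY g|n].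
  exact: (@HF_full (exist _ X hX) (exist _ Y hY) g).
split=> IH X Y hX hY.
  have [[X' I] [Y' J]] := (susp_surj X, susp_surj Y).
  apply: lifts_iso (isomorphic_sym I) (isomorphic_sym J) _.
  by apply/lifts_susp; apply: IH; apply: (weq_susp _ _ _).1;
    [apply: weq_iso I hX | apply: weq_iso J hY].
by apply/lifts_susp; apply: IH; apply: (weq_susp _ _ _).2.
Qed.

Lemma weq_nil_kernel n X : weq w n X -> nil_kernel X.
Proof.
move: n X; apply: int_ind_iff => [X hX e Fe|n].
  have [k Ek] := @HF_nil (exist _ X hX) e Fe; by exists k.
split=> IH X hX.
  have [X' I] := susp_surj X.
  apply: nil_kernel_iso (isomorphic_sym I) _.
  by apply/nil_kernel_susp; apply: IH; apply: (weq_susp _ _ _).1; apply: weq_iso I hX.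
by apply/nil_kernel_susp; apply: IH; apply: (weq_susp _ _ _).2.
Qed.

(** A splitting of the identity of a layer of [F M], as in
    [contraction_of_no_weight], lifts to a pair [rho], [tau] over [M] by
    fullness.  The defect of the splitting is then in the kernel of [F], hence
    nilpotent. *)
Lemma no_weight_reflect n M : no_weight w' n (F M) -> no_weight w n M.
Proof.
(* The middle one of the three layers involved has index [n - 1], the lowest
   one [n - 2]. *)
have -> : n = n - 1 - 1 + 1 + 1 by lia.
move: (n - 1 - 1) => {}n h; have [t] := tower_exists w M.
have [rho' [tau' E]] := contraction_of_no_weight (tower_image t) h.
have hN k := (weq_susp _ _ _).2 (tw_layerP t k).
have [rho Er] := weq_lifts (hN (n + 1)) (tw_layerP t (n + 1 + 1))
  (rho' \oc efun_susp F (tw_layer t (n + 1))).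
have [tau Et] := weq_lifts (hN n) (tw_layerP t (n + 1))
  (tau' \oc efun_susp F (tw_layer t n)).
apply: (@no_weight_of_contraction _ _ _ t n rho tau).
apply: weq_nil_kernel (hN (n + 1)) _ _.
apply: (iso_monic (efun_susp_iso F _)).
have := congr1 (fun h => h \oc efun_susp F (tw_layer t (n + 1))) E.
rewrite !tower_image_d comp1m compmDl => {}E.
rewrite !fmapB fmap1 !compmBr compm1 compm0 efun_susp_nat.
rewrite [fmap F (_ \oc rho)]fmapM [fmap F (tau \oc _)]fmapM Er Et.
by rewrite [X in X - _ - _]E !compmA addrAC addrK subrr.
Qed.

End Transport.

(** * Contractible complexes *)

Section Contraction.
Variables (A : preadditive) (K : complex A).

(** The maps [rho] and [tau] of different degrees are unrelated.  The degrees
    are linked by equations so that the condition applies directly to the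
    indices [- (n + 1)] and [- n] of a weight complex. *)
Definition degreewise_contractible : Prop :=
  forall i j k (e : i + 1 = j) (e' : j + 1 = k),
  exists (rho : mor (K j) (K i)) (tau : mor (K k) (K j)),
    idm (K j) = cpx_diff K e \oc rho + tau \oc cpx_diff K e'.

Lemma cpx_diff_diff i j k (e : i + 1 = j) (e' : j + 1 = k) :
  cpx_diff K e' \oc cpx_diff K e = 0.
Proof. by case: k / e'; case: j / e; apply: cpx_dd. Qed.

Lemma contractible_degreewise : zero_in_homotopy_category K -> degreewise_contractible.
Proof.
move=> [Z [f [g [Z0 [h hP] _]]]] i j k e e'; case: k / e'; case: j / e.
exists (- h i), (- h (i + 1)); rewrite /cpx_diff /=.
have := hP i; rewrite ((Z0 _).2 _ (g (i + 1))) comp0m sub0r.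
by move/eqP; rewrite eqr_oppLR => /eqP ->; rewrite compmN compNm opprD.
Qed.

(** With [id = d sigma_j + theta_j d] in each degree [j], the relation
    [d theta_i d = d] makes [h_i = theta_i (id - theta_{i+1} d)] a contraction:
    [d h_i = id - theta_{i+1} d] and [h_{i+1} d = theta_{i+1} d]. *)
Lemma degreewise_contractible_zero (Z : A) : is_zero_object Z ->
  degreewise_contractible -> zero_in_homotopy_category K.
Proof.
move=> [Z1 Z2] hK.
have [sg /dep_choice[th thP]] := dep_choice
  (fun j => hK _ j _ (subrK 1 j) erefl).
have dtd i j (e : j + 1 = i + 1) : cpx_d K i \oc th i \oc cpx_diff K e = cpx_diff K e.
  have ji : j = i by apply: addIr e.
  case: i / ji e => e; rewrite (eq_irrelevance e erefl) /cpx_diff /= -compmA.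
  have := congr1 (compm (cpx_d K j)) (thP j).
  rewrite compm1 compmDr compmA (cpx_diff_diff (subrK 1 j) erefl) comp0m add0r.
  by rewrite /cpx_diff /= => <-.
have zero_dd (i : int) : (0 : mor Z Z) \oc (0 : mor Z Z) = 0 by rewrite comp0m.
pose Zc := @Complex A (fun=> Z) (fun=> 0) zero_dd.
have f0P i : cpx_d Zc i \oc (0 : mor (K i) Z) = 0 \oc cpx_d K i by rewrite !comp0m.
have g0P i : cpx_d K i \oc (0 : mor Z (K i)) = 0 \oc cpx_d Zc i by rewrite compm0 comp0m.
have hP i : idm (K i) - th i \oc cpx_d K i = cpx_diff K (subrK 1 i) \oc sg i.
  by apply/eqP; rewrite subr_eq; apply/eqP; apply: thP.
pose h i := th i \oc (idm _ - th (i + 1) \oc cpx_d K (i + 1)).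
have dh i : cpx_d K i \oc h i = idm _ - th (i + 1) \oc cpx_d K (i + 1).
  by rewrite /h compmA hP compmA dtd.
have hd i : h i \oc cpx_d K i = th i \oc cpx_d K i.
  by rewrite /h -compmA compmBl comp1m -[th _ \oc _ \oc _]compmA cpx_dd compm0 subr0.
exists Zc, (@ChainMap A K Zc (fun=> 0) f0P), (@ChainMap A Zc K (fun=> 0) g0P).
split=> //.
  exists (fun i => - h i) => i /=.
  by rewrite comp0m sub0r compmN compNm dh hd -opprD subrK.
by exists (fun=> 0) => i; rewrite [LHS]Z1 [RHS]Z1.
Qed.

End Contraction.

(** * Families indexed by the integers *)

(** A weight complex has components of types [T (n + 1)] and [T (- (n + 1))].
    The next two lemmas turn such components into families over all integers
    whose values at these indices are the given ones, without casts. *)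

Lemma int_fun_succ (T : int -> Type) (f : forall n : int, T (n + 1)) :
  exists h : forall n, T n, forall n, h (n + 1) = f n.
Proof.
exists (fun m => ecast k (T k) (subrK 1 m) (f (m - 1))) => n.
move: (subrK 1 (n + 1)); have -> : n + 1 - 1 = n by rewrite addrK.
by move=> e; rewrite (eq_irrelevance e erefl).
Qed.

Lemma opp_succK (i : int) : - (- i - 1 + 1) = i.
Proof. by rewrite subrK opprK. Qed.

Lemma int_fun_opp_succ (T : int -> Type) (f : forall n : int, T (- (n + 1))) :
  exists h : forall i, T i, forall n, h (- (n + 1)) = f n.
Proof.
exists (fun i => ecast k (T k) (opp_succK i) (f (- i - 1))) => n.
move: (opp_succK (- (n + 1))); have -> : - - (n + 1) - 1 = n by rewrite opprK addrK.
by move=> e; rewrite (eq_irrelevance e erefl).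
Qed.

(** * Weight complexes *)

Section WeightComplexes.
Variables (C : triangulated) (w : weight_structure C) (M : C).

(** The weights [>= n] and [<= n] of [X] are witnessed by a priori different
    desuspensions of [X], which are isomorphic as shifts are fully faithful. *)
Lemma weq_heart n X : weq w n X -> exists K : heart w, X ~= shift C n (sval K).
Proof.
move=> [[Y [hY I]] [Z [hZ J]]].
have [Sfull Sfaith] := shift_full_faithful C n.
have YZ : Y ~= Z.
  exact: full_faithful_iso Sfull Sfaith _ _ (isomorphic_trans (isomorphic_sym I) J).
have hY0 : weq w 0 Y.
  split; first exact/wge0E.
  by apply: wle_iso YZ _; apply/wle0E.
by exists (exist _ Y hY0).
Qed.

Lemma heart_zero : exists Z : heart w, is_zero_object Z.
Proof.
have [[Z [Z1 Z2]] _] := tcat_additive C.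
have hZ : weq w 0 Z.
  split; first by rewrite -[0](addNr 1); apply: wge_of_orth => X f _; apply: Z1.
  by apply: wle_of_orth => X f _; apply: Z2.
by exists (exist _ Z hZ); split=> [[X hX] f|[X hX] f]; [apply: Z1 | apply: Z2].
Qed.

Definition tower_of_weight_complex (t : weight_complex w M) : tower w M :=
  @Tower C w M (wc_le t) (wc_ge t) (wc_c t) (wc_r t) (wc_b t) (wc_dec t) (wc_g t)
    (wc_gP t) (fun n => shift C (n + 1) (sval (t (- (n + 1)))))
    (fun n => wc_p t (n + 1)) (wc_q t) (wc_tri t).

Section OneComplex.
Variable t : weight_complex w M.
Let s := tower_of_weight_complex t.
Let hdiff n : mor (sval (t (- (n + 1)))) (sval (t (- n))) := cpx_diff t (opp_succ n).

(** Up to the canonical isomorphism [X[n + 1][1] ~= X[n + 2]], the differential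
    of the weight complex is the one of the tower. *)
Lemma wc_tw_d n :
  fmap (shift C (n + 1 + 1)) (hdiff (n + 1)) = shiftS (n + 1) _ \oc tw_d s n.
Proof. exact: wc_diff. Qed.

Lemma wc_no_weight : degreewise_contractible t -> forall n, no_weight w n M.
Proof.
move=> ht n; have -> : n = n - 1 - 1 + 1 + 1 by lia.
move: (n - 1 - 1) => {}n.
have [rho [tau E]] := ht _ _ _ (opp_succ (n + 1 + 1)) (opp_succ (n + 1)).
have {}E : idm (sval (t (- (n + 1 + 1)))) =
  hdiff (n + 1 + 1) \oc rho + (tau : mor (sval _) (sval _)) \oc hdiff (n + 1) := E.
apply: (@no_weight_of_contraction _ _ _ s n
  (fmap (shift C (n + 1 + 1 + 1)) rho \oc shiftS (n + 1 + 1) _)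
  (fmap (shift C (n + 1 + 1)) tau \oc shiftS (n + 1) _)).
exists 1%N; rewrite /= compm1.
apply: (iso_monic (shiftS_iso (n + 1 + 1) (sval (t (- (n + 1 + 1)))))).
rewrite -[_ \oc tw_d s n]compmA -wc_tw_d -fmapM compm0 !compmBr compm1.
rewrite compmA compmA -wc_tw_d -fmapM -shiftS_nat.
apply/eqP; rewrite subr_eq0 subr_eq [X in _ == X]addrC.
by rewrite -compmDl -fmapD -E fmap1 comp1m.
Qed.

(** The splitting of the identity on a layer, which lives [n + 3] shifts above
    the heart, is brought back by full faithfulness of shifts. *)
Lemma wc_contractible : (forall n, no_weight w n M) -> degreewise_contractible t.
Proof.
move=> hM i j k e e'.
have [n En] : exists n, i = - (n + 1 + 1 + 1) by exists (- i - 3); lia.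
have Ej : j = - (n + 1 + 1) by lia.
have Ek : k = - (n + 1) by lia.
move: e e'; rewrite {}En {}Ej {}Ek => e e'.
rewrite (eq_irrelevance e (opp_succ _)) (eq_irrelevance e' (opp_succ _)).
have [rho [tau E]] := contraction_of_no_weight s (hM (n + 1 + 1)).
have [S [SS' S'S]] := shiftS_iso (n + 1 + 1) (sval (t (- (n + 1 + 1)))).
have [S1 [SS1' S1'S]] := shiftS_iso (n + 1) (sval (t (- (n + 1)))).
have [rho' Er] := (shift_full_faithful C (n + 1 + 1 + 1)).1 _ _ (rho \oc S).
have [tau' Et] := (shift_full_faithful C (n + 1 + 1)).1 _ _ (tau \oc S1).
exists rho', tau'.
suff: idm (sval (t (- (n + 1 + 1)))) =
  hdiff (n + 1 + 1) \oc rho' + (tau' : mor (sval _) (sval _)) \oc hdiff (n + 1) by [].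
apply: (shift_full_faithful C (n + 1 + 1 + 1)).2.
apply: (iso_epic (shiftS_iso (n + 1 + 1) _)).
rewrite fmapD compmDl [fmap _ (_ \oc rho')]fmapM wc_tw_d Er fmap1 comp1m.
rewrite shiftS_nat [fmap _ (tau' \oc _)]fmapM wc_tw_d Et.
rewrite -[LHS]compm1 [in LHS]E compmDr !compmA; congr (_ + _).
  by rewrite -[RHS]compmA SS' compm1.
by rewrite -[tau \oc S1 \oc _]compmA SS1' compm1.
Qed.

Lemma wc_zeroP : zero_in_homotopy_category t <-> (forall n, no_weight w n M).
Proof.
split=> [/contractible_degreewise/wc_no_weight //|/wc_contractible ht].
by have [Z Z0] := heart_zero; apply: degreewise_contractible_zero Z0 ht.
Qed.

End OneComplex.

Lemma weight_complex_exists : inhabited (weight_complex w M).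
Proof.
have [s] := tower_exists w M.
have [K0 K0P] := dep_choice (fun n => weq_heart (tw_layerP s n)).
have [K KP] := @int_fun_opp_succ (fun=> heart w) K0.
have isoK n : tw_layer s n ~= shift C (n + 1) (sval (K (- (n + 1)))) by rewrite KP.
(* The layers of the tower are replaced by the isomorphic shifts of [K]. *)
have [th thP] := dep_choice isoK; have [th' th'P] := dep_choice thP.
pose p1 n := th n \oc tw_u s n; pose q n := tw_q s n \oc th' n.
have tri1 n : dist (tw_g s n) (p1 n) (q n).
  apply: (dist_iso (id_is_iso _) (id_is_iso _) (thP n) _ _ _ (tw_tri s n)).
  - by rewrite comp1m compm1.
  - by rewrite compm1.
  - by rewrite fmap1 comp1m -compmA (th'P n).1 compm1.
clearbody p1 q.
have [p Ep] := @int_fun_succ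
  (fun n => mor (tw_le s n) (shift C n (sval (K (- n))))) p1.
have tri n : dist (tw_g s n) (p (n + 1)) (q n) by rewrite Ep.
have [de deP] := dep_choice (fun n => (shift_full_faithful C (n + 1)).1 _ _
  (shiftS n (sval (K (- n))) \oc ((p n)^[1] \oc q n))).
have [d dP] := @int_fun_opp_succ (fun i => mor (K i) (K (i + 1)))
  (fun n => ecast k (mor (K (- (n + 1))) (K k)) (esym (opp_succ n)) (de n)).
have deE n : ecast k (mor (K (- (n + 1))) (K k)) (opp_succ n) (d (- (n + 1))) = de n.
  by rewrite dP; move: (de n); case: _ / (opp_succ n).
have dede n : de n \oc de (n + 1) = 0.
  apply: (shift_full_faithful C (n + 1)).2; rewrite fmap0 fmapM.
  apply: susp_faithful; rewrite fmap0 fmapM.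
  have -> : (fmap (shift C (n + 1)) (de (n + 1)))^[1]
      = (p (n + 1))^[1] \oc q (n + 1) \oc shiftS (n + 1) _.
    by apply: (iso_monic (shiftS_iso (n + 1) _)); rewrite -shiftS_nat deP !compmA.
  rewrite deP !fmapM !compmA -[_ \oc _ \oc (p _)^[1]]compmA -(fmapM _ (q n)).
  by rewrite (dist_comp1 (tri n)) fmap0 compm0 !comp0m.
(* Every degree [i] is [- (n + 2)], and the casts disappear once the three
   degrees involved are generalized. *)
have dd i : d (i + 1) \oc d i = 0.
  have [n ->] : exists n, i = - (n + 1 + 1) by exists (- i - 2); lia.
  have := dede n; rewrite -!deE.
  move: (opp_succ n) (opp_succ (n + 1)); move: (- n) (- (n + 1)) (- (n + 1 + 1)).
  by move=> k j l e e'; case: k / e; case: j / e'.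
pose Kc := @Complex (heart w) K d dd.
have diffE n : fmap (shift C (n + 1)) (cpx_diff Kc (opp_succ n))
    = shiftS n (sval (Kc (- n))) \oc ((p n)^[1] \oc q n).
  by rewrite /cpx_diff deE.
exact: inhabits (@WeightComplex C w M Kc (tw_le s) (tw_ge s) (tw_c s) (tw_r s) (tw_b s)
  (tw_dec s) (tw_g s) (tw_gP s) p q tri diffE).
Qed.

Lemma w_degenerateP : w_degenerate w M <-> forall n, no_weight w n M.
Proof.
split=> [[t /wc_zeroP]//|hM]; have [t] := weight_complex_exists.
by exists t; apply/wc_zeroP.
Qed.

End WeightComplexes.

(** * Essentially positive and essentially negative objects *)

Section Biproduct.
Variables (A : preadditive) (X Y S : A).
Variables (i1 : mor X S) (i2 : mor Y S) (p1 : mor S X) (p2 : mor S Y).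
Hypothesis B : is_biproduct i1 i2 p1 p2.

Lemma biproduct_ext W (a b : mor W S) :
  p1 \oc a = p1 \oc b -> p2 \oc a = p2 \oc b -> a = b.
Proof.
case: B => _ _ _ _ E E1 E2; rewrite -[a]comp1m -[b]comp1m -E !compmDl.
by rewrite -!compmA E1 E2.
Qed.

Lemma biproduct_coext W (a b : mor S W) :
  a \oc i1 = b \oc i1 -> a \oc i2 = b \oc i2 -> a = b.
Proof.
case: B => _ _ _ _ E E1 E2; rewrite -[a]compm1 -[b]compm1 -E !compmDr.
by rewrite !compmA E1 E2.
Qed.

Lemma biproduct_pair W (a : mor W X) (b : mor W Y) :
  exists c : mor W S, p1 \oc c = a /\ p2 \oc c = b.
Proof.
case: B => E1 E2 E3 E4 _; exists (i1 \oc a + i2 \oc b).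
by rewrite !compmDr !compmA E1 E2 E3 E4 !comp1m !comp0m addr0 add0r.
Qed.

End Biproduct.

Section Essential.
Variables (C : triangulated) (w : weight_structure C).

Definition kills_maps_to k (A : C) (e : mor A A) : Prop :=
  forall Y (y : mor A Y), wge w k Y -> y \oc e = 0.

Definition kills_maps_from k (B : C) (e : mor B B) : Prop :=
  forall Y (y : mor Y B), wle w k Y -> e \oc y = 0.

Lemma kills_maps_to_susp k (A : C) (e : mor A A) :
  kills_maps_to k e -> kills_maps_to (k + 1) e^[1].
Proof.
move=> he Y y hY; have [Y' [i Ii]] := susp_surj Y; have [j [ji ij]] := Ii.
have [y' Ey] := susp_full (j \oc y).
apply: (@iso_monic _ _ _ _ j); first by exists i.
rewrite compm0 compmA -Ey -fmapM (he _ y') ?fmap0 //.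
by apply: (wge_susp _ _ _).1; apply: wge_iso hY; exists i.
Qed.

(** For each [k <= -1], [f] factors as [A -> w_{<=k-1} M -> A -> M], which gives
    an endomorphism of [A] over [M] that kills maps to weights [>= k].  The one for
    [k = -1] works for all [k] at once: for any [e'] with [f e' = f], the map
    [id - e'] factors through the desuspension of [B], which has weights
    [>= -1], so that [(id - e') e = 0]. *)
Lemma degenerate_projector_left M A B (f : mor A M) (r : mor M B) b :
    dist f r b -> wle w (-1) A -> wge w 0 B ->
    (forall i : int, i <= -1 -> no_weight w i M) ->
  exists e : mor A A,
    [/\ f \oc e = f, e \oc e = e & forall k, kills_maps_to k e].
Proof.
move=> T hA hB hM.
have step (k : int) : exists e : mor A A, f \oc e = f /\ kills_maps_to k e.
  pose m := Num.min k (-1).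
  have [A' [B' [c [r' [d [T' hA' hB']]]]]] := weight_decomposition_exists w (m - 1) M.
  rewrite subrK in hB'.
  have [x Ex] : exists x, c \oc x = f.
    apply: (dist_factor_left T'); apply: (@no_weight_range _ w m (-1)) hA hB'.
      by move=> i hi; apply: hM; lia.
    by rewrite /m; lia.
  have [g Eg] : exists g, f \oc g = c.
    by apply: (dist_factor_left T); apply: orth_lt hA' hB; rewrite /m; lia.
  exists (g \oc x); split=> [|Y y hY]; first by rewrite compmA Eg.
  rewrite compmA (_ : y \oc g = 0) ?comp0m //.
  by apply: orth_lt hA' hY; rewrite /m; lia.
have [e [fe he]] := step (-1); exists e.
have absorb e' : f \oc e' = f -> e' \oc e = e.
  move=> fe'; have [s Es] : exists s, b \oc s = (idm A - e')^[1].
    by apply: (dist_factor_left2 T); rewrite -fmapM compmBr compm1 fe' subrr fmap0.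
  have: ((idm A - e') \oc e)^[1] = 0.
    rewrite fmapM -Es -compmA (kills_maps_to_susp he) ?compm0 //.
  move/susp_eq0; rewrite compmBl comp1m => /eqP.
  by rewrite subr_eq0 => /eqP <-.
split=> // [|k Y y hY]; first exact: absorb.
have [e' [fe' he']] := step k.
by rewrite -(absorb e' fe') compmA he' ?comp0m.
Qed.

(** The dual argument: [id - e'] now factors through the suspension of [A],
    which has weights [<= 1]. *)
Lemma degenerate_projector_right M A B (a : mor A M) (f : mor M B) b :
    dist a f b -> wle w 0 A -> wge w 1 B ->
    (forall i : int, 1 <= i -> no_weight w i M) ->
  exists e : mor B B,
    [/\ e \oc f = f, e \oc e = e & forall k, kills_maps_from k e].
Proof.
move=> T hA hB hM.
have step (k : int) : exists e : mor B B, e \oc f = f /\ kills_maps_from k e.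
  pose m := Num.max k 1.
  have [A' [B' [a' [c [d [T' hA' hB']]]]]] := weight_decomposition_exists w m M.
  have [x Ex] : exists x, x \oc c = f.
    apply: (dist_factor_right T'); apply: (@no_weight_range _ w 1 m) hA' hB.
      by move=> i hi; apply: hM; lia.
    by rewrite /m; lia.
  have [g Eg] : exists g, g \oc f = c.
    by apply: (dist_factor_right T); apply: orth_lt hA hB'; rewrite /m; lia.
  exists (x \oc g); split=> [|Y y hY]; first by rewrite -compmA Eg.
  rewrite -compmA (_ : g \oc y = 0) ?compm0 //.
  by apply: orth_lt hY hB'; rewrite /m; lia.
have [e [ef he]] := step 1; exists e.
have absorb e' : e' \oc f = f -> e \oc e' = e.
  move=> e'f; have [s Es] : exists s, s \oc b = idm B - e'.
    by apply: (dist_factor_right1 T); rewrite compmBl comp1m e'f subrr.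
  have: e \oc (idm B - e') = 0.
    by rewrite -Es compmA he ?comp0m //; apply: ((wle_susp w 0 A).2 hA).
  move/eqP; rewrite compmBr compm1.
  by rewrite subr_eq0 => /eqP <-.
split=> // [|k Y y hY]; first exact: absorb.
have [e' [e'f he']] := step k.
by rewrite -(absorb e' e'f) -compmA he' ?compm0.
Qed.

(** If [X] denotes the formal image of [e], then [D] is [X + X[1]] and
    represents the functor sending [T] to the [e]-parts of [Hom(T, A)] and of
    [Hom(T, A[1])]; this is why it maps to [M + M[1]].  The cone of that map has
    weights [>= 0] because, on [T] of weights [<= -1], the map is onto on
    [Hom(T, -)] and one-to-one on [Hom(T, -[1])]. *)
Lemma essentially_positiveP M :
  essentially_positive w M <-> (forall i : int, i <= -1 -> no_weight w i M).
Proof.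
split=> [[M' [A [B [ret hA hB [f [g [h T]]]]]]] i hi|hM].
  apply: no_weight_retract ret _ => X Y x y hX hY.
  have i0 : i < 0 by lia.
  have [x' <-] := dist_factor_left T (orth_lt (g \oc x) i0 hX hB).
  have i1 : i - 1 < i by lia.
  by rewrite compmA (orth_lt (y \oc f) i1 (hA _) hY) comp0m.
have [A [B [f [r [b [T hA hB]]]]]] := weight_decomposition_exists w (-1) M.
rewrite addNr in hB.
have [e [fe ee ke]] := degenerate_projector_left T hA hB hM.
have [D [j [k TD]]] := dist_cone (idm A - e).
have [phi Ephi] : exists phi, phi \oc j = f.
  by apply: (dist_factor_right TD); rewrite compmBr compm1 fe subrr.
have [S [i1 [i2 [p1 [p2 Sb]]]]] := (tcat_additive C).2 M (susp M).
have [chi [Ec1 Ec2]] := biproduct_pair Sb phi (f^[1] \oc k).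
have [B' [pi [h TS]]] := dist_cone chi.
exists S, D, B'; split; last by exists chi, pi, h.
- by case: Sb => E _ _ _ _; exists i1, p1.
- move=> i; apply: wle_of_orth => Y y hY.
  have yj : y \oc j = 0.
    have := dist_comp0 TD; move/(congr1 (compm y)).
    by rewrite compm0 compmA compmBr compm1 (ke _ _ (y \oc j) hY) subr0.
  have [s <-] := dist_factor_right1 TD yj.
  have se : s \oc e^[1] = 0 by apply: (kills_maps_to_susp (ke (i + 1 - 1))); rewrite subrK.
  have := congr1 (compm s) (dist_comp2 TD).
  by rewrite fmapB fmap1 compm0 compmBl comp1m compmBr compmA se comp0m subr0.
- rewrite -[0](addNr 1); apply: wge_of_orth => X x hX.
  (* Injectivity on [Hom(X, -[1])], then surjectivity on [Hom(X, -)]. *)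
  have hx0 : h \oc x = 0.
    have chx : chi^[1] \oc (h \oc x) = 0 by rewrite compmA (dist_comp2 TS) comp0m.
    have fkx : f^[1]^[1] \oc (k^[1] \oc (h \oc x)) = 0.
      by rewrite compmA -fmapM -Ec2 fmapM -compmA chx compm0.
    have [y Ey] := dist_factor_left2 (dist_susp T) fkx.
    have y0 : y = 0 by apply: orth_lt hX ((wge_susp _ _ _).2 hB).
    have kx : - k^[1] \oc (h \oc x) = 0.
      by rewrite compNm -Ey y0 compm0 oppr0.
    have [s Es] := dist_factor_left1 (dist_susp TD) kx.
    have fs : f^[1] \oc s = 0.
      by rewrite -Ephi fmapM -compmA Es -Ec1 fmapM -compmA chx compm0.
    have [z Ez] := dist_factor_left2 T fs.
    by rewrite -Es -Ez (orth_lt z _ hX hB) ?compm0.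
  have [y <-] := dist_factor_left1 TS hx0.
  have [z Ez] := dist_factor_left (dist_susp T)
    (orth_lt (r^[1] \oc (p2 \oc y)) (isT : (-1 : int) < 0 + 1) hX ((wge_susp _ _ _).2 hB)).
  have [z1 Ez1] : exists z1, k \oc z1 = e^[1] \oc z.
    apply: (dist_factor_left2 TD).
    by rewrite compmA -fmapM compmBl comp1m ee subrr fmap0 comp0m.
  have [z2 Ez2] := dist_factor_left T
    (orth_lt (r \oc (p1 \oc y - phi \oc z1)) (isT : (-1 : int) < 0) hX hB).
  suff -> : y = chi \oc (z1 + j \oc z2) by rewrite compmA (dist_comp0 TS) comp0m.
  apply: (biproduct_ext Sb); rewrite compmA ?Ec1 ?Ec2 compmDr compmA.
    by rewrite Ephi Ez2 addrC subrK.
  rewrite -[_ \oc k \oc j]compmA (dist_comp1 TD) compm0 comp0m addr0.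
  by rewrite -compmA Ez1 compmA -fmapM fe Ez.
Qed.

(** Dually, [D] is [X + X[-1]] for the formal image [X] of [e], and it receives
    a map from [M + M[-1]], with [M0] for [M[-1]].  The fibre has weights [<= 0]
    because, for [T] of weights [>= 1], the map is onto on [Hom(-, T)] and
    one-to-one on [Hom(-, T[1])]. *)
Lemma essentially_negativeP M :
  essentially_negative w M <-> (forall i : int, 1 <= i -> no_weight w i M).
Proof.
split=> [[M' [A [B [ret hA hB [f [g [h T]]]]]]] i hi|hM].
  apply: no_weight_retract ret _ => X Y x y hX hY.
  have i0 : 0 < i by lia.
  have [y' <-] := dist_factor_right T (orth_lt (y \oc f) i0 hA hY).
  have i1 : i < i + 1 by lia.
  by rewrite -compmA (orth_lt (g \oc x) i1 hX (hB _)) compm0.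
have [A [B [a [f [b [T hA hB]]]]]] := weight_decomposition_exists w 0 M.
rewrite add0r in hB.
have [e [ef ee ke]] := degenerate_projector_right T hA hB hM.
have [D [k [j TD]]] := dist_fiber (idm B - e).
have [phi Ephi] : exists phi, k \oc phi = f.
  by apply: (dist_factor_left TD); rewrite compmBl comp1m ef subrr.
have [M0 [u Iu]] := susp_surj M; have [u' [u'u uu']] := Iu.
have [psi Epsi] := susp_full (j \oc f \oc u).
have [S [i1 [i2 [p1 [p2 Sb]]]]] := (tcat_additive C).2 M M0.
have [chi [Ec1 Ec2]] : exists chi : mor S D, chi \oc i1 = phi /\ chi \oc i2 = psi.
  exists (phi \oc p1 + psi \oc p2); case: Sb => E1 E2 E3 E4 _.
  by rewrite !compmDl -!compmA E1 E2 E3 E4 !compm1 !compm0 addr0 add0r.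
have [A' [c [h TS]]] := dist_fiber chi.
have kpsi : k \oc psi = 0.
  apply: susp_eq0; rewrite fmapM Epsi !compmA (dist_comp2 TD).
  by rewrite !comp0m.
exists S, A', D; split; last by exists c, chi, h.
- by case: Sb => E _ _ _ _; exists i1, p1.
- apply: wle_of_orth => X x hX.
  (* Injectivity on [Hom(-, X[1])], then surjectivity on [Hom(-, X)]. *)
  have xh0 : x^[1] \oc h = 0.
    have xhc : x^[1] \oc h \oc chi = 0 by rewrite -compmA (dist_comp1 TS) compm0.
    set z := x^[1] \oc h in xhc *.
    have hX1 := (wge_susp w _ _).2 hX.
    have zj : z^[1] \oc j \oc f = 0.
      apply: (iso_epic Iu); rewrite comp0m -!compmA [j \oc (f \oc u)]compmA.
      by rewrite -Epsi -fmapM -Ec2 compmA xhc comp0m fmap0.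
    have [y Ey] := dist_factor_right1 T zj.
    have y0 : y = 0.
      by apply: (orth_lt y _ ((wle_susp w 0 A).2 hA) ((wge_susp w _ _).2 hX1)); lia.
    have zj0 : z^[1] \oc j = 0 by rewrite -Ey y0 comp0m.
    have [v Ev] := dist_factor_right2 TD zj0.
    have vf : v \oc f = 0 by rewrite -Ephi compmA Ev -Ec1 compmA xhc comp0m.
    have [v' Ev'] := dist_factor_right1 T vf.
    have v0 : v' = 0 by apply: (orth_lt v' _ ((wle_susp w 0 A).2 hA) hX1); lia.
    by rewrite -Ev -Ev' v0 !comp0m.
  have [y <-] := dist_factor_right2 TS xh0.
  have hX1 := (wge_susp w _ _).2 hX.
  have [z Ez] := dist_factor_right T
    (orth_lt ((y \oc i2)^[1] \oc u' \oc a) (isT : (0 : int) < 0 + 1 + 1) hA hX1).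
  have [z1 Ez1] : exists z1, z1 \oc j = z \oc e.
    apply: (dist_factor_right1 TD).
    by rewrite -compmA compmBr compm1 ee subrr compm0.
  have [z1' Ez1'] := susp_full z1.
  have [z2 Ez2] := dist_factor_right T
    (orth_lt ((y \oc i1 - z1' \oc phi) \oc a) (isT : (0 : int) < 0 + 1) hA hX).
  suff -> : y = (z1' + z2 \oc k) \oc chi by rewrite -compmA (dist_comp0 TS) compm0.
  apply: (biproduct_coext Sb); rewrite -compmA ?Ec1 ?Ec2 compmDl -[z2 \oc k \oc _]compmA.
    by rewrite Ephi Ez2 addrC subrK.
  rewrite kpsi compm0 addr0; apply: susp_faithful.
  rewrite [RHS]fmapM Ez1' Epsi !compmA Ez1 -[z \oc e \oc f]compmA ef Ez.
  by rewrite -compmA u'u compm1.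
- move=> i; rewrite -[i](subrK 1); apply: wge_of_orth => Y y hY.
  have ky : k \oc y = 0.
    have := dist_comp0 TD; move/(congr1 (fun m => m \oc y)).
    by rewrite comp0m -compmA compmBl comp1m (ke _ _ (k \oc y) hY) subr0.
  apply: susp_eq0.
  have ky1 : k^[1] \oc y^[1] = 0 by rewrite -fmapM ky fmap0.
  have [s <-] := dist_factor_left2 TD ky1.
  have es : e \oc s = 0 by apply: (ke (i - 1 + 1)); apply: (wle_susp _ _ _).2.
  have := congr1 (fun m => m \oc s) (dist_comp1 TD).
  by rewrite comp0m -compmA compmBl comp1m es subr0.
Qed.

End Essential.

(** * Reflection of weights by the functor *)

Theorem proposition3p2p1 (C C' : triangulated)
    (w : weight_structure C) (w' : weight_structure C')
    (F : exact_functor C C') (Fw : weight_exact w w' F)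
    (HF_full : full (heart_functor Fw))
    (HF_nil : forall (X : heart w) (e : mor X X),
       fmap (heart_functor Fw) e = 0 -> nilpotent_endo e)
    (M : C) :
  (forall m n : int, m <= n ->
     without_weights w' m n (F M) -> without_weights w m n M) /\
  (w_degenerate w' (F M) -> w_degenerate w M) /\
  (essentially_positive w' (F M) -> essentially_positive w M) /\
  (essentially_negative w' (F M) -> essentially_negative w M).
Proof.
have reflect n := no_weight_reflect HF_full HF_nil (n := n) (M := M).
split; [move=> m n mn | split; [|split]].
- by move=> /(without_weightsP _ _ mn) h; apply/without_weightsP => // i /h/reflect.
- by move=> /w_degenerateP h; apply/w_degenerateP => i; apply/reflect/h.
- by move=> /essentially_positiveP h; apply/essentially_positiveP => i /h/reflect.
- by move=> /essentially_negativeP h; apply/essentially_negativeP => i /h/reflect.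
Qed.
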